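(* Let $n\ge 2$. Then \[\mathfrak{e}_{C_{2n}}\cong \mathfrak{sp}_{2n}\ltimes(V_\lambda\oplus V_{\mathbf 0}),\] the semidirect product of $\mathfrak{sp}_{2n}$ with the abelian Lie algebra $V_\lambda\oplus V_{\mathbf 0}$ on which $\mathfrak{sp}_{2n}$ acts by the given representation, where $V_\lambda$ is the irreducible representation of $\mathfrak{sp}_{2n}$ of highest weight $\lambda=\omega_1+\omega_2$ and $V_{\mathbf 0}$ is the trivial one-dimensional representation.
   Context: All Lie algebras are over $\mathbb{C}$. The electrical Lie algebra $\mathfrak{e}_{C_m}$ is generated by $e_1,\dots,e_m$ subject to: $[e_i,e_j]=0$ if $|i-j|\ge 2$; $[e_i,[e_i,e_j]]=-2e_i$ if $|i-j|=1$ and $i\ne 1$; and $[e_1,[e_1,[e_1,e_2]]]=0$. $\mathfrak{sp}_{2n}$ is the symplectic Lie algebra of $2n\times 2n$ matrices, and $\omega_1,\omega_2$ are its first and second fundamental weights.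
   Formalization: Here ω_1, ω_2 are read as the coordinate weights ε_1, ε_2, so λ = ε_1+ε_2 (the second fundamental weight); with λ the sum of the first two fundamental weights the claim fails by dimension for every n≥2 (n=2: 27 > 16). *)

(* Defs.v *)
From HB Require Import structures.
From mathcomp Require Import all_boot all_order all_algebra.
From mathcomp Require Import generic_quotient ring boolp reals complex.

Set Implicit Arguments.
Unset Strict Implicit.
Unset Printing Implicit Defensive.

Import GRing.Theory.
Local Open Scope quotient_scope.
Local Open Scope ring_scope.

HB.mixin Record Lmodule_isLieAlgebra (K : fieldType) L
    of GRing.Lmodule K L := {
  lie : L -> L -> L;
  lie_linearl : forall y : L, linear (lie^~ y);
  lie_linearr : forall x : L, linear (lie x);
  liexx : forall x : L, lie x x = 0;
  lie_jacobi : forall x y z : L,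
    lie x (lie y z) + lie y (lie z x) + lie z (lie x y) = 0
}.

#[short(type="lieAlgType")]
HB.structure Definition LieAlgebra (K : fieldType) :=
  { L of GRing.Lmodule K L & Lmodule_isLieAlgebra K L }.

Notation "[lie x , y ]" := (lie x y)
  (at level 0, x, y at level 99, format "[lie  x ,  y ]") : ring_scope.

Section LieTheory.
Variables (K : fieldType) (L : lieAlgType K).
Implicit Types x y z : L.

Lemma lieDl x y z : [lie x + y, z] = [lie x, z] + [lie y, z].
Proof. by have := lie_linearl z 1 x y; rewrite !scale1r. Qed.

Lemma lieDr x y z : [lie x, y + z] = [lie x, y] + [lie x, z].
Proof. by have := lie_linearr x 1 y z; rewrite !scale1r. Qed.

Lemma lie0l y : [lie 0, y] = 0.
Proof. by apply: (addIr [lie 0, y]); rewrite -lieDl !add0r. Qed.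

Lemma lie0r x : [lie x, 0] = 0.
Proof. by apply: (addIr [lie x, 0]); rewrite -lieDr !add0r. Qed.

Lemma lieZl a x y : [lie a *: x, y] = a *: [lie x, y].
Proof. by have := lie_linearl y a x 0; rewrite !addr0 lie0l addr0. Qed.

Lemma lieZr a x y : [lie x, a *: y] = a *: [lie x, y].
Proof. by have := lie_linearr x a y 0; rewrite !addr0 lie0r addr0. Qed.

End LieTheory.

Definition lie_isomorphic (K : fieldType) (L1 L2 : lieAlgType K) : Prop :=
  exists f : {linear L1 -> L2},
    bijective f /\ forall x y : L1, f [lie x, y] = [lie f x, f y].

(** Formal Lie expressions in generators [X], modulo the smallest congruence
    that contains the relations and the axioms of a Lie algebra. *)

Inductive lie_term (K X : Type) : Type :=
| LGen of X
| LZero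
| LAdd of lie_term K X & lie_term K X
| LScale of K & lie_term K X
| LBracket of lie_term K X & lie_term K X.

Arguments LGen {K X}.
Arguments LZero {K X}.

HB.instance Definition _ (K X : Type) := gen_eqMixin (lie_term K X).
HB.instance Definition _ (K X : Type) := gen_choiceMixin (lie_term K X).

Section Presentation.
Variables (K : fieldType) (X : Type).
Variable rel : lie_term K X -> lie_term K X -> Prop.
Local Notation T := (lie_term K X).

Inductive lie_cong : T -> T -> Prop :=
| lc_rel s t of rel s t : lie_cong s t
| lc_refl s : lie_cong s s
| lc_sym s t of lie_cong s t : lie_cong t s
| lc_trans s t u of lie_cong s t & lie_cong t u : lie_cong s u
| lc_add s s' t t' of lie_cong s s' & lie_cong t t' :
    lie_cong (LAdd s t) (LAdd s' t')
| lc_scale a s s' of lie_cong s s' : lie_cong (LScale a s) (LScale a s')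
| lc_bracket s s' t t' of lie_cong s s' & lie_cong t t' :
    lie_cong (LBracket s t) (LBracket s' t')
| lc_addA s t u : lie_cong (LAdd s (LAdd t u)) (LAdd (LAdd s t) u)
| lc_addC s t : lie_cong (LAdd s t) (LAdd t s)
| lc_add0 s : lie_cong (LAdd LZero s) s
| lc_addN s : lie_cong (LAdd (LScale (-1) s) s) LZero
| lc_scaleA a b s : lie_cong (LScale a (LScale b s)) (LScale (a * b) s)
| lc_scale1 s : lie_cong (LScale 1 s) s
| lc_scaleDr a s t :
    lie_cong (LScale a (LAdd s t)) (LAdd (LScale a s) (LScale a t))
| lc_scaleDl a b s :
    lie_cong (LScale (a + b) s) (LAdd (LScale a s) (LScale b s))
| lc_bracketl a s t u : lie_cong (LBracket (LAdd (LScale a s) t) u)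
    (LAdd (LScale a (LBracket s u)) (LBracket t u))
| lc_bracketr a s t u : lie_cong (LBracket u (LAdd (LScale a s) t))
    (LAdd (LScale a (LBracket u s)) (LBracket u t))
| lc_bracketxx s : lie_cong (LBracket s s) LZero
| lc_jacobi s t u : lie_cong
    (LAdd (LAdd (LBracket s (LBracket t u)) (LBracket t (LBracket u s)))
          (LBracket u (LBracket s t))) LZero.

Definition lie_congb (s t : T) : bool := `[< lie_cong s t >].

Lemma lie_congb_equiv : equiv_class_of lie_congb.
Proof.
split=> [s|s t|t s u].
- by apply/asboolP; apply: lc_refl.
- by apply/asboolP/asboolP => /lc_sym.
- by move=> /asboolP st /asboolP tu; apply/asboolP; apply: lc_trans st tu.
Qed.

Canonical lie_cong_equiv := EquivRelPack lie_congb_equiv.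

Definition presented_lie := {eq_quot lie_cong_equiv}.
HB.instance Definition _ := Choice.on presented_lie.

Local Notation Q := presented_lie.
Definition lie_class (s : T) : Q := (\pi_({eq_quot lie_cong_equiv}) s)%qT.

Lemma lie_classP s t : lie_class s = lie_class t <-> lie_cong s t.
Proof.
rewrite /lie_class; split=> [/eqquotP/asboolP //|st].
by apply/eqquotP/asboolP.
Qed.

Lemma lie_class_ind (P : Q -> Prop) :
  (forall s, P (lie_class s)) -> forall x, P x.
Proof. by move=> Ps x; rewrite -[x](@reprK _ {eq_quot lie_cong_equiv}); apply: Ps. Qed.

Definition lie_repr (x : Q) : T := repr (x : {eq_quot lie_cong_equiv}).

Lemma lie_reprP s : lie_cong (lie_repr (lie_class s)) s.
Proof. by apply/lie_classP; rewrite /lie_repr /lie_class reprK. Qed.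

Definition pl_zero : Q := lie_class LZero.
Definition pl_add (x y : Q) : Q := lie_class (LAdd (lie_repr x) (lie_repr y)).
Definition pl_scale a (x : Q) : Q := lie_class (LScale a (lie_repr x)).
Definition pl_opp : Q -> Q := pl_scale (-1).
Definition pl_bracket (x y : Q) : Q :=
  lie_class (LBracket (lie_repr x) (lie_repr y)).

Lemma pl_addE s t : pl_add (lie_class s) (lie_class t) = lie_class (LAdd s t).
Proof. by apply/lie_classP; apply: lc_add; apply: lie_reprP. Qed.

Lemma pl_scaleE a s : pl_scale a (lie_class s) = lie_class (LScale a s).
Proof. by apply/lie_classP; apply: lc_scale; apply: lie_reprP. Qed.

Lemma pl_bracketE s t :
  pl_bracket (lie_class s) (lie_class t) = lie_class (LBracket s t).
Proof. by apply/lie_classP; apply: lc_bracket; apply: lie_reprP. Qed.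

Lemma pl_addA : associative pl_add.
Proof.
elim/lie_class_ind=> s; elim/lie_class_ind=> t; elim/lie_class_ind=> u.
by rewrite !pl_addE; apply/lie_classP; apply: lc_addA.
Qed.

Lemma pl_addC : commutative pl_add.
Proof.
elim/lie_class_ind=> s; elim/lie_class_ind=> t.
by rewrite !pl_addE; apply/lie_classP; apply: lc_addC.
Qed.

Lemma pl_add0 : left_id pl_zero pl_add.
Proof.
elim/lie_class_ind=> s.
by rewrite pl_addE; apply/lie_classP; apply: lc_add0.
Qed.

Lemma pl_addN : left_inverse pl_zero pl_opp pl_add.
Proof.
elim/lie_class_ind=> s.
by rewrite /pl_opp pl_scaleE pl_addE; apply/lie_classP; apply: lc_addN.
Qed.

HB.instance Definition _ :=
  GRing.isZmodule.Build Q pl_addA pl_addC pl_add0 pl_addN.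

Lemma lie_classD s t : lie_class (LAdd s t) = lie_class s + lie_class t.
Proof. by rewrite -pl_addE. Qed.

Lemma pl_scaleA a b x : pl_scale a (pl_scale b x) = pl_scale (a * b) x.
Proof.
elim/lie_class_ind: x => s.
by rewrite !pl_scaleE; apply/lie_classP; apply: lc_scaleA.
Qed.

Lemma pl_scale1 : left_id 1 pl_scale.
Proof.
elim/lie_class_ind=> s.
by rewrite pl_scaleE; apply/lie_classP; apply: lc_scale1.
Qed.

Lemma pl_scaleDr : right_distributive pl_scale +%R.
Proof.
move=> a; elim/lie_class_ind=> s; elim/lie_class_ind=> t.
rewrite -lie_classD !pl_scaleE -lie_classD.
by apply/lie_classP; apply: lc_scaleDr.
Qed.

Lemma pl_scaleDl x : {morph pl_scale^~ x : a b / a + b}.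
Proof.
elim/lie_class_ind: x => s a b.
rewrite !pl_scaleE -lie_classD.
by apply/lie_classP; apply: lc_scaleDl.
Qed.

HB.instance Definition _ := GRing.Zmodule_isLmodule.Build K Q
  pl_scaleA pl_scale1 pl_scaleDr pl_scaleDl.

Lemma lie_classZ a s : lie_class (LScale a s) = a *: lie_class s.
Proof. by rewrite -pl_scaleE. Qed.

Lemma pl_bracket_linearl y : linear (pl_bracket^~ y).
Proof.
elim/lie_class_ind: y => u a; elim/lie_class_ind=> s; elim/lie_class_ind=> t.
rewrite -lie_classZ -lie_classD !pl_bracketE -lie_classZ -lie_classD.
by apply/lie_classP; apply: lc_bracketl.
Qed.

Lemma pl_bracket_linearr x : linear (pl_bracket x).
Proof.
elim/lie_class_ind: x => u a; elim/lie_class_ind=> s; elim/lie_class_ind=> t.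
rewrite -lie_classZ -lie_classD !pl_bracketE -lie_classZ -lie_classD.
by apply/lie_classP; apply: lc_bracketr.
Qed.

Lemma pl_bracketxx x : pl_bracket x x = 0.
Proof.
elim/lie_class_ind: x => s.
by rewrite pl_bracketE; apply/lie_classP; apply: lc_bracketxx.
Qed.

Lemma pl_jacobi x y z : pl_bracket x (pl_bracket y z)
  + pl_bracket y (pl_bracket z x) + pl_bracket z (pl_bracket x y) = 0.
Proof.
elim/lie_class_ind: x => s; elim/lie_class_ind: y => t.
elim/lie_class_ind: z => u; rewrite !pl_bracketE -!lie_classD.
by apply/lie_classP; apply: lc_jacobi.
Qed.

HB.instance Definition _ := Lmodule_isLieAlgebra.Build K Q
  pl_bracket_linearl pl_bracket_linearr pl_bracketxx pl_jacobi.

Definition pl_gen (i : X) : presented_lie := lie_class (LGen i).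

Lemma lie_class_bracket s t :
  lie_class (LBracket s t) = [lie lie_class s, lie_class t].
Proof. by rewrite -pl_bracketE. Qed.

Section Universal.
Variables (L : lieAlgType K) (f : X -> L).

Fixpoint lie_eval (t : T) : L :=
  match t with
  | LGen i => f i
  | LZero => 0
  | LAdd s t => lie_eval s + lie_eval t
  | LScale a s => a *: lie_eval s
  | LBracket s t => [lie lie_eval s, lie_eval t]
  end.

Hypothesis f_rel : forall s t, rel s t -> lie_eval s = lie_eval t.

Lemma lie_eval_cong s t : lie_cong s t -> lie_eval s = lie_eval t.
Proof.
elim=> {s t} /=.
- exact: f_rel.
- by [].
- by [].
- by move=> s t u _ -> _ ->.
- by move=> s s' t t' _ -> _ ->.
- by move=> a s s' _ ->.
- by move=> s s' t t' _ -> _ ->.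
- by move=> *; rewrite addrA.
- by move=> *; rewrite addrC.
- by move=> *; rewrite add0r.
- by move=> *; rewrite scaleN1r addNr.
- by move=> *; rewrite scalerA.
- by move=> *; rewrite scale1r.
- by move=> *; rewrite scalerDr.
- by move=> *; rewrite scalerDl.
- by move=> *; rewrite lieDl lieZl.
- by move=> *; rewrite lieDr lieZr.
- by move=> *; rewrite liexx.
- by move=> *; rewrite lie_jacobi.
Qed.

Definition pl_lift (x : presented_lie) : L := lie_eval (lie_repr x).

Lemma pl_liftE s : pl_lift (lie_class s) = lie_eval s.
Proof. exact/lie_eval_cong/lie_reprP. Qed.

Lemma pl_lift_is_linear : linear pl_lift.
Proof.
move=> a; elim/lie_class_ind=> s; elim/lie_class_ind=> t.
by rewrite -lie_classZ -lie_classD !pl_liftE.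
Qed.

Lemma presented_lie_universal : exists g : {linear presented_lie -> L},
  [/\ forall x y, g [lie x, y] = [lie g x, g y],
      forall i, g (pl_gen i) = f i
    & forall h : {linear presented_lie -> L},
        (forall x y, h [lie x, y] = [lie h x, h y]) ->
        (forall i, h (pl_gen i) = f i) -> h =1 g].
Proof.
pose gM := GRing.isLinear.Build _ _ _ _ pl_lift pl_lift_is_linear.
pose g : {linear presented_lie -> L} := HB.pack pl_lift gM.
exists g; split=> [|i|h hM hgen].
- elim/lie_class_ind=> s; elim/lie_class_ind=> t.
  by rewrite -lie_class_bracket /= !pl_liftE.
- by rewrite /= pl_liftE.
elim/lie_class_ind=> s; rewrite /= pl_liftE.
elim: s => [i||s IHs t IHt|a s IHs|s IHs t IHt] /=.
- exact: hgen.
- exact: raddf0.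
- by rewrite lie_classD raddfD /= IHs IHt.
- by rewrite lie_classZ linearZ /= IHs.
- by rewrite lie_class_bracket hM IHs IHt.
Qed.

End Universal.
End Presentation.

(** The generator $e_k$ is [LGen i] with [i = k.-1 : 'I_m]; in particular the
    exceptional generator $e_1$ has index [0]. *)

Section Electrical.
Variables (K : fieldType) (m : nat).
Local Notation e i := (@LGen K 'I_m i).

Variant electricalC_rel : lie_term K 'I_m -> lie_term K 'I_m -> Prop :=
| elC_far (i j : 'I_m) of (i.+1 < j)%N || (j.+1 < i)%N :
    electricalC_rel (LBracket (e i) (e j)) LZero
| elC_adj (i j : 'I_m) of
    ((i.+1 == j :> nat) || (j.+1 == i :> nat)) && (i != 0 :> nat)%N :
    electricalC_rel (LBracket (e i) (LBracket (e i) (e j)))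
                    (LScale (- 2%:R) (e i))
| elC_first (i j : 'I_m) of (i == 0 :> nat)%N && (j == 1 :> nat)%N :
    electricalC_rel
      (LBracket (e i) (LBracket (e i) (LBracket (e i) (e j)))) LZero.

Definition electricalC : lieAlgType K := presented_lie electricalC_rel.

End Electrical.

(** [symplectic K n] is $\mathfrak{sp}_{2n}$, the matrices $X$ with
    $X^T J + J X = 0$; in block form $X = (A, B; C, -A^T)$ with $B$, $C$
    symmetric. *)

Section Symplectic.
Variables (K : fieldType) (n : nat).

Definition symp_form : 'M[K]_(n + n) := block_mx 0 1%:M (- 1%:M) 0.

Definition symp_pred : {pred 'M[K]_(n + n)} :=
  fun X => X^T *m symp_form + symp_form *m X == 0.

Lemma symp_predP X :
  reflect (X^T *m symp_form + symp_form *m X = 0) (X \in symp_pred).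
Proof. exact: eqP. Qed.

Lemma symp_submod : submod_closed symp_pred.
Proof.
split=> [|a X Y /symp_predP hX /symp_predP hY]; apply/symp_predP.
  by rewrite trmx0 mul0mx mulmx0 addr0.
rewrite linearP /= mulmxDl mulmxDr -scalemxAl -scalemxAr addrACA -scalerDr.
by rewrite hX hY scaler0 addr0.
Qed.
HB.instance Definition _ :=
  GRing.isSubmodClosed.Build K 'M[K]_(n + n) symp_pred symp_submod.

Record symplectic := Symplectic {
  symp_mx :> 'M[K]_(n + n);
  symp_mxP : symp_mx \in symp_pred
}.
HB.instance Definition _ := [isSub for symp_mx].
HB.instance Definition _ := [Choice of symplectic by <:].
HB.instance Definition _ := [SubChoice_isSubLmodule of symplectic by <:].

Lemma symp_bracket_subproof (X Y : symplectic) :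
  (X : 'M_(n + n)) *m Y - (Y : 'M_(n + n)) *m X \in symp_pred.
Proof.
have tr (Z : symplectic) : (Z : 'M_(n + n))^T *m symp_form
    = - (symp_form *m (Z : 'M_(n + n))).
  by apply/eqP; rewrite -addr_eq0; apply/eqP/symp_predP/symp_mxP.
apply/symp_predP; rewrite linearB /= !trmx_mul mulmxBl mulmxBr.
rewrite -!mulmxA !tr !mulmxN !mulmxA !tr !mulNmx !opprK.
by rewrite addrC subrKA subrr.
Qed.

Definition symp_bracket (X Y : symplectic) : symplectic :=
  Symplectic (symp_bracket_subproof X Y).

Lemma symp_bracket_linearl Y : linear (symp_bracket^~ Y).
Proof.
move=> a X X'; apply: val_inj => /=.
rewrite mulmxDl mulmxDr -scalemxAl -scalemxAr scalerBr opprD.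
by rewrite addrACA.
Qed.

Lemma symp_bracket_linearr X : linear (symp_bracket X).
Proof.
move=> a Y Y'; apply: val_inj => /=.
rewrite mulmxDl mulmxDr -scalemxAl -scalemxAr scalerBr opprD.
by rewrite addrACA.
Qed.

Lemma symp_bracketxx X : symp_bracket X X = 0.
Proof. by apply: val_inj; rewrite /= subrr. Qed.

Lemma symp_jacobi X Y Z : symp_bracket X (symp_bracket Y Z)
  + symp_bracket Y (symp_bracket Z X) + symp_bracket Z (symp_bracket X Y) = 0.
Proof.
apply: val_inj => /=; rewrite !mulmxBl !mulmxBr !mulmxA.
set a := X *m Y *m Z; set b := X *m Z *m Y; set c := Y *m Z *m X.
set d := Y *m X *m Z; set e := Z *m X *m Y; set f := Z *m Y *m X.
rewrite !opprB; apply/matrixP => i j; rewrite !mxE.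
by ring.
Qed.

HB.instance Definition _ := Lmodule_isLieAlgebra.Build K symplectic
  symp_bracket_linearl symp_bracket_linearr symp_bracketxx symp_jacobi.

Lemma symp_lieE (X Y : symplectic) :
  [lie X, Y] = X *m Y - Y *m X :> 'M[K]_(n + n).
Proof. by []. Qed.

(** Cartan subalgebra of diagonal matrices, and the nilradical of the standard
    Borel: with $\varepsilon_i$ the $i$-th diagonal entry, the positive roots
    are $\varepsilon_i - \varepsilon_j$ ($i<j$) and
    $\varepsilon_i + \varepsilon_j$ ($i \le j$). *)

Definition symp_cartan (H : symplectic) : Prop := is_diag_mx (symp_mx H).

Definition symp_nilpos (X : symplectic) : Prop :=
  (forall i j : 'I_n, (j <= i)%N -> ulsubmx (symp_mx X) i j = 0) /\
  dlsubmx (symp_mx X) = 0.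

End Symplectic.

Record lie_rep (K : fieldType) (L : lieAlgType K) (V : lmodType K) := LieRep {
  rep_act :> L -> V -> V;
  rep_linearl : forall v, linear (rep_act^~ v);
  rep_linearr : forall x, linear (rep_act x);
  rep_bracket : forall x y v, rep_act [lie x, y] v =
    rep_act x (rep_act y v) - rep_act y (rep_act x v)
}.

Section Representations.
Variables (K : fieldType) (L : lieAlgType K).

Definition rep_stable (V : lmodType K) (rho : lie_rep L V)
    (P : V -> Prop) : Prop :=
  [/\ P 0, forall (a : K) u v, P u -> P v -> P (a *: u + v)
    & forall x v, P v -> P (rho x v)].

Definition irreducible_rep (V : lmodType K) (rho : lie_rep L V) : Prop :=
  (exists v : V, v != 0) /\
  forall P, rep_stable rho P -> (forall v, P v -> v = 0) \/ (forall v, P v).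

Lemma rep_trivial_linearl (V : lmodType K) (v : V) : linear (fun _ : L => 0 : V).
Proof. by move=> a x y; rewrite scaler0 addr0. Qed.

Lemma rep_trivial_linearr (V : lmodType K) (x : L) : linear (fun _ : V => 0 : V).
Proof. by move=> a u v; rewrite scaler0 addr0. Qed.

Lemma rep_trivial_bracket (V : lmodType K) (x y : L) (v : V) : 0 = 0 - 0 :> V.
Proof. by rewrite subr0. Qed.

Definition rep_trivial (V : lmodType K) : lie_rep L V :=
  LieRep (@rep_trivial_linearl V) (@rep_trivial_linearr V)
         (@rep_trivial_bracket V).

Section DirectSum.
Variables (V W : lmodType K) (rho : lie_rep L V) (sigma : lie_rep L W).

Definition rep_sum_act (x : L) (u : V * W) : V * W := (rho x u.1, sigma x u.2).

Lemma rep_sum_linearl u : linear (rep_sum_act^~ u).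
Proof. by move=> a x y; congr pair; rewrite /= rep_linearl. Qed.

Lemma rep_sum_linearr x : linear (rep_sum_act x).
Proof. by move=> a u v; congr pair; rewrite /= rep_linearr. Qed.

Lemma rep_sum_bracket x y u : rep_sum_act [lie x, y] u =
  rep_sum_act x (rep_sum_act y u) - rep_sum_act y (rep_sum_act x u).
Proof. by congr pair; rewrite /= rep_bracket. Qed.

Definition rep_sum : lie_rep L (V * W)%type :=
  LieRep rep_sum_linearl rep_sum_linearr rep_sum_bracket.

End DirectSum.

End Representations.

(** Semidirect product with a representation seen as an abelian ideal. *)

Definition semidirect (K : fieldType) (L : lieAlgType K) (V : lmodType K)
    (rho : lie_rep L V) : Type := (L * V)%type.

HB.instance Definition _ (K : fieldType) (L : lieAlgType K) (V : lmodType K)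
    (rho : lie_rep L V) :=
  GRing.Lmodule.copy (semidirect rho) (L * V)%type.

Section Semidirect.
Variables (K : fieldType) (L : lieAlgType K) (V : lmodType K).
Variable rho : lie_rep L V.
Local Notation S := (semidirect rho).

Definition semidirect_bracket (p q : S) : S :=
  ([lie p.1, q.1], rho p.1 q.2 - rho q.1 p.2).

Lemma semidirect_linearl q : linear (semidirect_bracket^~ q).
Proof.
move=> a p p'; congr pair; rewrite /=; first by rewrite lie_linearl.
rewrite rep_linearl rep_linearr scalerBr opprD.
by rewrite addrACA.
Qed.

Lemma semidirect_linearr p : linear (semidirect_bracket p).
Proof.
move=> a q q'; congr pair; rewrite /=; first by rewrite lie_linearr.
rewrite rep_linearl rep_linearr scalerBr opprD.
by rewrite addrACA.
Qed.

Lemma semidirectxx p : semidirect_bracket p p = 0.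
Proof. by congr pair; rewrite /= ?liexx ?subrr. Qed.

Lemma rep_actB x u v : rho x (u - v) = rho x u - rho x v.
Proof.
by rewrite addrC -scaleN1r rep_linearr scaleN1r addrC.
Qed.

Lemma semidirect_jacobi p q r :
  semidirect_bracket p (semidirect_bracket q r)
  + semidirect_bracket q (semidirect_bracket r p)
  + semidirect_bracket r (semidirect_bracket p q) = 0.
Proof.
congr pair; rewrite /=; first by rewrite lie_jacobi.
rewrite !rep_actB !rep_bracket.
move: (rho p.1 (rho q.1 r.2)) (rho p.1 (rho r.1 q.2)) => a b.
move: (rho q.1 (rho r.1 p.2)) (rho q.1 (rho p.1 r.2)) => c d.
move: (rho r.1 (rho p.1 q.2)) (rho r.1 (rho q.1 p.2)) => e f.
rewrite !opprB [X in X + _ + _]addrACA [X in _ + X + _]addrACA.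
rewrite [X in _ + X]addrACA.
rewrite -!opprD (addrC c) (addrC e) (addrC f) !subrKA.
by rewrite subrr.
Qed.

HB.instance Definition _ := Lmodule_isLieAlgebra.Build K S
  semidirect_linearl semidirect_linearr semidirectxx semidirect_jacobi.

End Semidirect.

Section HighestWeight.
Variables (K : fieldType) (n : nat).
Local Notation sp := (symplectic K n).

(** [symp_weight k] is the weight $\varepsilon_k$, $1 \le k \le n$, sending
    $\mathrm{diag}(t_1,\dots,t_n,-t_1,\dots,-t_n)$ to $t_k$. *)
Definition symp_weight (k : nat) (H : sp) : K :=
  \sum_(i < n | i.+1 == k) symp_mx H (lshift n i) (lshift n i).

(** Here $\lambda = \omega_1 + \omega_2$ with $\omega_k = \varepsilon_k$, so
    $\dim V_\lambda = 2n^2 - n - 1$.  In the convention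
    $\omega_k = \varepsilon_1 + \dots + \varepsilon_k$ this $\lambda$ is the
    single weight $\omega_2$; the sum of the first two weights in that
    convention is $2\varepsilon_1 + \varepsilon_2$, whose representation is too
    large: $\dim \mathfrak{e}_{C_{2n}} \le 4n^2$, while for $n = 2$ it gives
    $10 + 16 + 1 > 16$. *)
Definition symp_lambda (H : sp) : K := symp_weight 1 H + symp_weight 2 H.

Definition highest_weight_vector (V : lmodType K) (rho : lie_rep sp V)
    (mu : sp -> K) (v : V) : Prop :=
  [/\ v != 0, forall X : sp, symp_nilpos X -> rho X v = 0
    & forall H : sp, symp_cartan H -> rho H v = mu H *: v].

Definition irreducible_highest_weight (V : lmodType K) (rho : lie_rep sp V)
    (mu : sp -> K) : Prop :=
  irreducible_rep rho /\ exists v : V, highest_weight_vector rho mu v.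

End HighestWeight.

(* Main.v *)
(** Let [J] be the matrix of the symplectic form [omega] on [K^(2n)]. The
    adjoint action splits [gl_2n] into [sp_2n] and the [omega]-selfadjoint
    matrices, and the traceless selfadjoint ones form [V_lambda]. Choose
    vectors [v_1, ..., v_2n] with [omega (v_i, v_(i+1)) = 1] and [omega
    (v_i, v_j) = 0] for [|i - j| >= 2]. The signed transvections [(-1)^(i+1)
    v_i v_i^T J] satisfy the type [A] electrical relations, and an abelian
    component [(p, 1)] may be added to the first of them when [p] is killed
    by every generator but the second: of the relations only [[e_1, [e_1,
    e_2]] = -2 e_1] breaks, and its weaker type [C] form survives. The
    resulting homomorphism is surjective because [V_lambda] is irreducible.
    It is injective because the [4n^2 = dim gl_2n] brackets [[e_(i+d), ...,
    [e_(i+1), e_i]]] and [[s_i, s_j]], where [s_i] is the bracket running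
    from [e_1] to [e_i], already span the electrical algebra. An arbitrary
    irreducible module of highest weight [lambda] is identified with the
    concrete one through the submodule of the product generated by the pair
    of highest weight vectors, which is the graph of an isomorphism. *)

Require Import Defs.
From HB Require Import structures.
From mathcomp Require Import all_boot all_order all_algebra.
From mathcomp Require Import zify ring boolp reals complex.

Set Implicit Arguments.
Unset Strict Implicit.
Unset Printing Implicit Defensive.

Import GRing.Theory Num.Theory.
Local Open Scope ring_scope.

(** * Linear spans and identities in Lie algebras *)

Section LinearSpan.
Variables (K : fieldType) (V : lmodType K).

Definition subspace (P : V -> Prop) : Prop :=
  P 0 /\ forall (a : K) u v, P u -> P v -> P (a *: u + v).

Lemma subspaceD P u v : subspace P -> P u -> P v -> P (u + v).
Proof. by move=> [_ lP] Pu Pv; rewrite -(scale1r u); apply: lP. Qed.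

Lemma subspaceZ P a u : subspace P -> P u -> P (a *: u).
Proof. by move=> [P0 lP] Pu; rewrite -(addr0 (a *: u)); apply: lP. Qed.

Lemma subspaceN P u : subspace P -> P u -> P (- u).
Proof. by move=> sP Pu; rewrite -scaleN1r; apply: subspaceZ. Qed.

Lemma subspaceB P u v : subspace P -> P u -> P v -> P (u - v).
Proof. by move=> sP Pu Pv; apply: subspaceD => //; apply: subspaceN. Qed.

Lemma subspace_sum P (I : Type) (r : seq I) (p : pred I) (F : I -> V) :
  subspace P -> (forall i, p i -> P (F i)) -> P (\sum_(i <- r | p i) F i).
Proof.
move=> sP PF; elim/big_ind: _ => //; first by case: sP.
by move=> u v; apply: subspaceD.
Qed.

Inductive span (S : V -> Prop) : V -> Prop :=
| span_zero : span S 0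
| span_gen v of S v : span S v
| span_lin (a : K) u v of span S u & span S v : span S (a *: u + v).

Lemma subspace_span S : subspace (span S).
Proof. by split; [apply: span_zero | move=> *; apply: span_lin]. Qed.

Lemma span_sub (S P : V -> Prop) :
  subspace P -> (forall v, S v -> P v) -> forall v, span S v -> P v.
Proof.
move=> [P0 lP] SP v; elim=> {v} [|v /SP //|a u v _ Pu _ Pv] //.
exact: lP.
Qed.

Lemma span_finP (I : finType) (x : I -> V) v :
  span (fun w => exists i, w = x i) v ->
  exists c : I -> K, v = \sum_i c i *: x i.
Proof.
elim=> {v} [|v [i ->]|a u v _ [c ->] _ [d ->]].
- by exists (fun=> 0); rewrite big1 // => i _; rewrite scale0r.
- exists (fun j => (j == i)%:R); rewrite (bigD1 i) //= eqxx scale1r.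
  by rewrite big1 ?addr0 // => j /negPf ->; rewrite scale0r.
exists (fun i => a * c i + d i); rewrite scaler_sumr -big_split /=.
by apply: eq_bigr => i _; rewrite scalerDl scalerA.
Qed.

End LinearSpan.

Section LieIdentities.
Variables (K : fieldType) (L : lieAlgType K).
Implicit Types x y z w : L.

Lemma lieC x y : [lie x, y] = - [lie y, x].
Proof.
have := liexx (x + y); rewrite lieDl !lieDr !liexx add0r addr0.
by move/eqP; rewrite addr_eq0 => /eqP.
Qed.

Lemma lieNr x y : [lie x, - y] = - [lie x, y].
Proof. by rewrite -scaleN1r lieZr scaleN1r. Qed.

Lemma lie_leibniz x y z :
  [lie x, [lie y, z]] = [lie [lie x, y], z] + [lie y, [lie x, z]].
Proof.
have := lie_jacobi x y z; rewrite (lieC z x) lieNr (lieC z [lie x, y]).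
by move/eqP; rewrite subr_eq0 subr_eq => /eqP.
Qed.

Lemma lie_lie x y z :
  [lie [lie x, y], z] = [lie x, [lie y, z]] - [lie y, [lie x, z]].
Proof. by rewrite lie_leibniz addrK. Qed.

Lemma lie_comm x y z :
  [lie x, y] = 0 -> [lie x, [lie y, z]] = [lie y, [lie x, z]].
Proof. by move=> xy0; rewrite lie_leibniz xy0 lie0l add0r. Qed.

(** Bracket the hypothesis with [z] on the right: since [x] commutes with [z], expansion gives the
    goal on the left and a multiple of [[lie x, z]] on the right. *)
Lemma lie_electric_sq (a : K) x y z : [lie x, [lie x, y]] = a *: x ->
  [lie x, z] = 0 -> [lie x, [lie x, [lie y, z]]] = 0.
Proof.
move=> xxy xz; have := congr1 (lie^~ z) xxy => /=.
by rewrite !lie_lie xz !lie0r !subr0 lieZl xz scaler0.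
Qed.

(** Bracketing the hypothesis with [z] expands to -2 X + Y = -2 [x, z], where X is the left side of
    the goal and Y = [y, [x, [x, z]]]; solve for X. *)
Lemma lie_electric_swap x y z : 2%:R != 0 :> K ->
  [lie x, [lie x, y]] = (- 2%:R) *: x -> [lie y, z] = 0 ->
  [lie x, [lie y, [lie x, z]]] = [lie x, z] + 2%:R^-1 *: [lie y, [lie x, [lie x, z]]].
Proof.
move=> two xxy yz; have := congr1 (lie^~ z) xxy => /=.
rewrite !lie_lie yz lie0r sub0r lieNr lieZl scaleNr => /eqP.
set X := [lie x, [lie y, _]]; set Y := [lie y, _].
rewrite -opprD eqr_opp addrA subr_eq => /eqP X_eq.
apply: (scalerI two); rewrite scalerDr scalerA divff // scale1r -X_eq.
by rewrite scaler_nat mulr2n.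
Qed.

End LieIdentities.
Section LieRepresentations.
Variables (K : fieldType) (L : lieAlgType K) (V : lmodType K) (r : lie_rep L V).

Lemma rep0 x : r x 0 = 0.
Proof. by have := rep_linearr r x (-1) 0 0; rewrite scaler0 addr0 scaleN1r addNr. Qed.

Lemma repZl a x w :
  r (a *: x) w = a *: r x w.
Proof.
have r0 : r 0 w = 0.
  by have := rep_linearl r w (-1) 0 0; rewrite scaler0 addr0 scaleN1r addNr.
by have := rep_linearl r w a x 0; rewrite r0 !addr0.
Qed.

Lemma repZr a x w :
  r x (a *: w) = a *: r x w.
Proof. by have := rep_linearr r x a w 0; rewrite rep0 !addr0. Qed.

End LieRepresentations.

(** * A spanning family of the electrical Lie algebra *)

Section ElectricalSpan.
Variables (K : numFieldType) (L : lieAlgType K) (m : nat) (e : nat -> L).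

Hypothesis e_far : forall i j, (i < m)%N -> (j < m)%N ->
  (i.+1 < j)%N || (j.+1 < i)%N -> [lie e i, e j] = 0.
Hypothesis e_adj : forall i j, (0 < i < m)%N -> (j < m)%N ->
  (i.+1 == j) || (j.+1 == i) -> [lie e i, [lie e i, e j]] = (- 2%:R) *: e i.
Hypothesis e_first :
  (1 < m)%N -> [lie e 0, [lie e 0, [lie e 0, e 1]]] = 0.

(** The interval of generators from [i] to [i + d]; recording [d] rather than the right end lets
    induction on [d] add generators on the right. *)
Fixpoint br (i d : nat) : L :=
  if d is d'.+1 then [lie e (i + d), br i d'] else e i.

Let two0 : 2%:R != 0 :> K. Proof. by rewrite pnatr_eq0. Qed.

Lemma br_far k i d : (k < m)%N -> (i + d < m)%N ->
  (k.+1 < i)%N || ((i + d).+1 < k)%N -> [lie e k, br i d] = 0.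
Proof.
move=> km; elim: d => [|d IHd] im fark /=; first by apply: e_far => //; lia.
by rewrite lie_comm ?IHd ?lie0r //; [lia | lia | apply: e_far => //; lia].
Qed.

(** [e k] commutes with every generator of the interval but the first, so it moves inward until it
    meets [e i]. *)
Lemma br_below k i d : (k.+1 = i)%N -> (i + d < m)%N ->
  [lie e k, br i d] = - br k d.+1.
Proof.
move=> ki; elim: d => [|d IHd] im /=; first by rewrite lieC addn1 ki.
rewrite lie_comm; last by apply: e_far; lia.
rewrite IHd; last by lia.
by rewrite lieNr /= (_ : k + d.+2 = i + d.+1)%N //; lia.
Qed.

(** For [d = 1] this is the adjacent relation up to sign. For larger [d] the last generator commutes
    with [e k], so [e k] moves inward; at [d = 2] the inner value 2 e_k is killed by e_(k+2). *)
Lemma br_left k d : (0 < k)%N -> (k + d < m)%N ->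
  [lie e k, br k d] = if d == 1%N then 2%:R *: e k else 0.
Proof.
move=> k0; elim: d => [|[_|d IHd]] km; first by rewrite /= liexx.
- by rewrite /= addn1 (lieC (e k.+1)) lieNr e_adj ?scaleNr ?opprK ?eqxx //; lia.
rewrite [br _ _]/= lie_comm; last by apply: e_far; lia.
rewrite IHd; last by lia.
by case: d {IHd} km => [|d] km /=;
  rewrite ?lieZr ?e_far ?scaler0 ?lie0r //; lia.
Qed.

(** For [d >= 2] this is [lie_electric_sq] with x = e_k, y = e_(k-1) and z the interval ending at k
    - 2, which commutes with e_k. *)
Lemma br_right k i d : (i < k)%N -> (k = i + d)%N -> (k < m)%N ->
  [lie e k, br i d] = if d == 1%N then (- 2%:R) *: e k else 0.
Proof.
case: d => [|[|d]] ik kid km; first by lia.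
  by rewrite /= -kid e_adj //; lia.
rewrite [br _ _]/= -kid; apply: (@lie_electric_sq _ _ (- 2%:R)).
  by apply: e_adj; lia.
by apply: br_far; lia.
Qed.

(** The case [r = 0] is [lie_electric_swap], its last term being evaluated by [br_right]. Further
    generators e_(k+2), ... commute with e_k; they kill an interval ending at [k] and prolong one
    starting at [k]. *)
Lemma br_middle k i c r : (k = i + c.+1)%N -> (k + r.+1 < m)%N ->
  [lie e k, br i (c.+1 + r.+1)] =
    (if r == 0%N then br i c.+1 else 0) - (if c == 0%N then br k r.+1 else 0).
Proof.
move=> kic; elim: r => [|r IHr] km.
- rewrite addn1 /= (_ : i + c.+2 = k.+1)%N -?kic; last by lia.
  rewrite (@lie_electric_swap _ _ (e k) (e k.+1)) //; last first.
  + by apply: br_far; lia.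
  + by apply: e_adj; lia.
  rewrite addn1; congr (_ + _).
  have := @br_right k i c.+1; rewrite /= -kic => -> //; try lia.
  case: c {kic} => [|c] /=; last by rewrite lie0r scaler0 oppr0.
  by rewrite lieZr scalerA mulrN mulVf // scaleN1r.
rewrite addnS [br i _]/= lie_comm; last by apply: e_far; lia.
rewrite IHr; last by lia.
rewrite lieDr lieNr; congr (_ - _).
  case: (eqVneq r 0%N) => [r0|_]; last by rewrite lie0r.
  by apply: br_far; lia.
case: (c == 0%N); last by rewrite lie0r.
by rewrite /= (_ : i + _ = k + r.+2)%N //; lia.
Qed.

(** [br_from 1] is the subalgebra generated by all [e k] with [k > 0]; it acts on
    [br_from 0], the sum of it and the span of the [br 0 j]. *)
Definition br_from i0 : L -> Prop :=
  span (fun x => exists i d, [/\ (i0 <= i)%N, (i + d < m)%N & x = br i d]).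

Let sub_from i0 : subspace (br_from i0). Proof. exact: subspace_span. Qed.

Lemma br_fromE i0 i d : (i0 <= i)%N -> (i + d < m)%N -> br_from i0 (br i d).
Proof. by move=> i0i im; apply: span_gen; exists i, d. Qed.

Lemma br_from_ad i0 k x : (i0 <= 1)%N -> (0 < k < m)%N -> br_from i0 x ->
  br_from i0 [lie e k, x].
Proof.
move=> i01 km; apply: (span_sub (P := fun x => br_from i0 [lie e k, x])).
  split=> [|a u v Pu Pv]; first by rewrite lie0r; apply: span_zero.
  by rewrite lie_linearr; apply: span_lin.
move=> _ [i [d [i0i im ->]]].
have fr0 : br_from i0 0 by apply: span_zero.
have fre j : (i0 <= j)%N -> (j < m)%N -> br_from i0 (e j).
  by move=> i0j jm; apply: (@br_fromE _ _ 0) => //; lia.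
(* [k] can be far from the interval, just after or before it, its first, last, or an interior
   element. The bounds on [k] and [i0] give [i0 <= k], which admits the intervals starting at
   [k]. *)
have [far|] := boolP ((k.+1 < i)%N || ((i + d).+1 < k)%N).
  by rewrite br_far //; lia.
case: (eqVneq k (i + d).+1) => [kE _|kn1].
  by rewrite {1}kE -addnS; apply: (@br_fromE _ _ d.+1); lia.
case: (eqVneq k.+1 i) => [kE _|kn2].
  rewrite br_below //; apply: subspaceN => //; apply: br_fromE; lia.
case: (eqVneq k i) => [kE _|kn3].
  rewrite -kE br_left; [|lia|lia].
  by case: ifP => // _; apply: subspaceZ => //; apply: fre; lia.
case: (eqVneq k (i + d)%N) => [kE _|kn4 kfar].
  rewrite br_right; [|lia|lia|lia].
  by case: ifP => // _; apply: subspaceZ => //; apply: fre; lia.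
have -> : d = ((k - i).-1.+1 + (i + d - k).-1.+1)%N by lia.
rewrite br_middle; [|lia|lia]; apply: subspaceB => //.
  by case: ifP => // _; apply: br_fromE; lia.
by case: ifP => // _; apply: br_fromE; lia.
Qed.

Lemma br_from_br i0 x y : (i0 <= 1)%N ->
  br_from 1 x -> br_from i0 y -> br_from i0 [lie x, y].
Proof.
move=> i01 Px Py; move: x Px.
apply: (span_sub (P := fun x => br_from i0 [lie x, y])).
  split=> [|a u v Pu Pv]; first by rewrite lie0l; apply: span_zero.
  by rewrite lie_linearl; apply: span_lin.
move=> _ [i [d [i0i im ->]]]; elim: d im y Py => [|d IHd] im y Py /=.
  by apply: br_from_ad => //; lia.
rewrite lie_lie; apply: subspaceB => //.
  by apply: br_from_ad; [|lia|apply: IHd => //; lia].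
by apply: IHd; [lia|apply: br_from_ad => //; lia].
Qed.

Local Notation s j := (br 0 j).

(** The candidate for the whole algebra. Since [s 0] is [e 0], its stability under the exceptional
    generator is a statement about triple brackets of the [s j]. *)
Definition br_all : L -> Prop :=
  span (fun x => br_from 0 x \/
    exists i j, [/\ (i < m)%N, (j < m)%N & x = [lie s i, s j]]).

Let sub_all : subspace br_all. Proof. exact: subspace_span. Qed.

Lemma br_from_all x : br_from 0 x -> br_all x.
Proof. by move=> Px; apply: span_gen; left. Qed.

(** Intervals starting after 0 preserve [br_from 0] by [br_from_br], so only brackets of two
    intervals starting at 0 can leave it; this isolates them. *)
Lemma br_from_head i0 x : br_from i0 x ->
  exists2 y, br_from 1 y & exists2 z,
    span (fun w => exists2 j, (j < m)%N & w = s j) z & x = y + z.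
Proof.
elim=> {x} [|x [[|i] [d [_ im ->]]]|a u v _ [y Py [z Pz ->]] _ [y' Py' [z' Pz' ->]]].
- by exists 0; [|exists 0]; rewrite ?addr0 //; apply: span_zero.
- exists 0; first exact: span_zero.
  by exists (s d); rewrite ?add0r //; apply: span_gen; exists d.
- exists (br i.+1 d); first exact: br_fromE.
  by exists 0; rewrite ?addr0 //; apply: span_zero.
exists (a *: y + y'); first exact: span_lin.
exists (a *: z + z'); first exact: span_lin.
by rewrite scalerDr addrACA.
Qed.

Lemma br_all_from x y : br_from 0 x -> br_from 0 y -> br_all [lie x, y].
Proof.
move=> Px Py; have [x1 Px1 [x2 Px2 ->]] := br_from_head Px.
have [y1 Py1 [y2 Py2 ->]] := br_from_head Py.
have from0 i0 z : br_from i0 z -> br_from 0 z.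
  apply: span_sub => // _ [i [d [_ im ->]]]; exact: br_fromE.
have froms z : span (fun w => exists2 j, (j < m)%N & w = s j) z -> br_from 0 z.
  by apply: span_sub => // _ [j jm ->]; apply: br_fromE.
rewrite lieDl; apply: subspaceD => //.
  apply: br_from_all; apply: br_from_br => //.
  by apply: subspaceD => //; [apply: from0 Py1 | apply: froms].
rewrite lieDr; apply: subspaceD => //.
  rewrite lieC; apply: subspaceN => //.
  by apply: br_from_all; apply: br_from_br => //; apply: froms.
move: x2 Px2; apply: span_sub.
  split=> [|a u v Pu Pv]; first by rewrite lie0l; apply: span_zero.
  by rewrite lie_linearl; apply: span_lin.
move=> _ [i im ->]; move: y2 Py2; apply: span_sub.
  split=> [|a u v Pu Pv]; first by rewrite lie0r; apply: span_zero.
  by rewrite lie_linearr; apply: span_lin.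
by move=> _ [j jm ->]; apply: span_gen; right; exists i, j.
Qed.

(** The derivation [ad (e k)] preserves [br_from 0], hence sends [s_i, s_j] to a sum of brackets
    treated by [br_all_from]. *)
Lemma br_all_ad k x : (0 < k < m)%N -> br_all x -> br_all [lie e k, x].
Proof.
move=> km; apply: (span_sub (P := fun x => br_all [lie e k, x])).
  split=> [|a u v Pu Pv]; first by rewrite lie0r; apply: span_zero.
  by rewrite lie_linearr; apply: span_lin.
move=> y [Py|[i [j [im jm ->]]]].
  by apply: br_from_all; apply: br_from_ad.
rewrite lie_leibniz; apply: subspaceD => //; apply: br_all_from.
- by apply: br_from_ad => //; apply: br_fromE.
- exact: br_fromE.
- exact: br_fromE.
by apply: br_from_ad => //; apply: br_fromE.
Qed.

Let fromS j : (j < m)%N -> br_from 0 (s j).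
Proof. by move=> jm; apply: br_fromE. Qed.

(** Reduces [x] to the [s j]: a component in [br_from 1] bracketed with [u] stays in [br_from 0],
    and one more bracket lands in [br_all]. *)
Lemma br_all_double u x : (0 < m)%N -> br_from 0 u ->
  (forall j, (j < m)%N -> br_all [lie s 0, [lie u, s j]]) ->
  br_from 0 x -> br_all [lie s 0, [lie u, x]].
Proof.
move=> m0 Pu us /br_from_head[y Py [z Pz ->]].
have P0 := fromS m0.
rewrite !lieDr; apply: subspaceD => //.
  apply: br_all_from => //.
  by rewrite lieC; apply: subspaceN => //; apply: br_from_br.
move: z Pz; apply: (span_sub (P := fun z => br_all [lie s 0, [lie u, z]])).
  split=> [|a v w Pv Pw]; first by rewrite !lie0r; apply: span_zero.
  by rewrite !lie_linearr; apply: span_lin.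
by move=> _ [j jm ->]; apply: us.
Qed.

(** The generators from the third on commute with [s 0] and come out of the bracket, down to the
    exceptional relation at [j = 1]. *)
Lemma br_triple00 j : (j < m)%N -> [lie s 0, [lie s 0, s j]] = 0.
Proof.
elim: j => [|[_|j IHj]] jm.
- by rewrite liexx lie0r.
- by rewrite /= (lieC (e 1)) !lieNr e_first ?oppr0.
have e0s : [lie s 0, e j.+2] = 0 by apply: e_far; lia.
rewrite [s j.+2]/= -/(s j.+1) (lie_comm _ e0s) (lie_comm _ e0s) IHj ?lie0r //.
exact: ltnW.
Qed.

(** Apply the derivation [ad (e 1)] to [s_0, [s_0, s_j]] = 0; as s_1 = [e_1, s_0], the sum equals
    -[s_0, [s_0, [e_1, s_j]]]. *)
Lemma br_triple_sym j : (1 < m)%N -> (j < m)%N ->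
  br_all ([lie s 1, [lie s 0, s j]] + [lie s 0, [lie s 1, s j]]).
Proof.
move=> m1 jm; have m0 : (0 < m)%N by lia.
have E : [lie s 1, [lie s 0, s j]] + [lie s 0, [lie s 1, s j]]
    = - [lie s 0, [lie s 0, [lie e 1, s j]]].
  apply/eqP; rewrite -addr_eq0 -addrA -lieDr -lie_leibniz -lie_leibniz.
  by rewrite br_triple00 ?lie0r.
rewrite E; apply: subspaceN => //; apply: br_all_double => //.
- exact: fromS.
- by move=> i im; rewrite br_triple00 //; apply: span_zero.
by apply: br_from_ad; [|lia|apply: fromS].
Qed.

(** For [j = 2], put [f = [s_0, [s_1, s_2]]], [g = [s_1, [s_0, s_2]]] and
    [h = [s_2, [s_0, s_1]]].  Modulo [br_all], [f = - g] by [br_triple_sym] and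
    [h = - g] by applying [ad e_2] to the case [j = 1]; the Jacobi identity
    [f = g - h] then gives [3 g = 0]. *)
Lemma br_triple10 j : (1 < m)%N -> (j < m)%N -> br_all [lie s 1, [lie s 0, s j]].
Proof.
move=> m1; case: j => [|j]; first by rewrite liexx lie0r => _; apply: span_zero.
elim: j => [|[_|j IHj]] jm.
- by have := br_triple_sym m1 m1; rewrite liexx lie0r addr0.
- set g := [lie s 1, _].
  have fg := br_triple_sym m1 jm; rewrite -/g in fg.
  have e20 : [lie e 2, s 0] = 0 by apply: br_far; lia.
  have hg : br_all ([lie s 2, [lie s 0, s 1]] + g).
    have := br_triple_sym m1 m1; rewrite liexx lie0r addr0.
    move/(@br_all_ad 2); rewrite lie_leibniz (lie_comm (x := e 2)) //.
    by apply; lia.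
  have fE : [lie s 0, [lie s 1, s 2]] = g - [lie s 2, [lie s 0, s 1]].
    by rewrite lie_leibniz addrC (lieC [lie s 0, s 1]).
  have : br_all (3%:R *: g).
    suff -> : 3%:R *: g = (g + [lie s 0, [lie s 1, s 2]])
        + ([lie s 2, [lie s 0, s 1]] + g) by apply: subspaceD.
    rewrite fE addrA -addrA [_ + g]addrC addrA addrA addrAC -[g + g - _ + _]addrA.
    by rewrite addNr addr0 scaler_nat !mulrS mulr0n addr0 addrA.
  move/(subspaceZ 3%:R^-1 sub_all).
  by rewrite scalerA mulVf ?scale1r // pnatr_eq0.
(* The generator with index [j.+3] commutes with [s 0] and [s 1], so its adjoint action carries the
   previous case to this one. *)
have := IHj (ltnW jm) => /(@br_all_ad j.+3).
rewrite (lie_comm (x := e j.+3) (y := s 1)); last by apply: br_far; lia.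
rewrite (lie_comm (x := e j.+3) (y := s 0)); last by apply: br_far; lia.
by apply; lia.
Qed.

(** Induction on [i]: for [i >= 2] the generator e_i commutes with s_0, so applying [ad (e i)] to
    [s_0, [s_(i-1), s_j]] yields the wanted bracket plus [s_0, [s_(i-1), [e_i, s_j]]], which the
    induction hypothesis covers. *)
Lemma br_triple0 i j : (i < m)%N -> (j < m)%N ->
  br_all [lie s 0, [lie s i, s j]].
Proof.
elim: i j => [|[_|i IHi]] j im jm.
- by rewrite br_triple00 //; apply: span_zero.
- rewrite -[X in br_all X](addKr [lie s 1, [lie s 0, s j]]) addrC.
  apply: subspaceB => //; last exact: br_triple10.
  exact: br_triple_sym.
have i1m : (i.+1 < m)%N by lia.
rewrite -[X in br_all X](addrK [lie s 0, [lie s i.+1, [lie e i.+2, s j]]]).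
rewrite -lieDr -lie_leibniz -lie_comm; last by apply: br_far; lia.
apply: subspaceB => //; first by apply: br_all_ad; [lia|apply: IHi].
apply: br_all_double; [lia|exact: fromS| |].
  by move=> k km; apply: IHi.
by apply: br_from_ad; [|lia|apply: fromS].
Qed.

(** Pairs on or above the diagonal index intervals by their two ends, pairs below it index the
    brackets [s_i, s_j]. Thus there are exactly m^2 elements, the dimension of gl_m. *)
Definition br_family (p : 'I_m * 'I_m) : L :=
  if (p.1 <= p.2)%N then br p.1 (p.2 - p.1) else [lie s p.1, s p.2].

Lemma br_allP x : br_all x -> exists c, x = \sum_p c p *: br_family p.
Proof.
move=> Px; apply: span_finP; move: x Px.
apply: span_sub; first exact: subspace_span.
move=> x [Px|[i [j [im jm ->]]]].
  move: x Px; apply: span_sub; first exact: subspace_span.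
  move=> _ [i [d [_ im ->]]]; apply: span_gen.
  have im' : (i < m)%N by lia.
  by exists (Ordinal im', Ordinal im); rewrite /br_family /= leq_addr addKn.
wlog ji : i j im jm / (j < i)%N.
  move=> H; case: (ltngtP i j) => ij; last by rewrite ij liexx; apply: span_zero.
    by rewrite lieC; apply: subspaceN; [apply: subspace_span | apply: H].
  exact: H.
apply: span_gen; exists (Ordinal im, Ordinal jm).
by rewrite /br_family /= leqNgt ji.
Qed.

(** [br_all] contains the generators and is stable under each [ad (e i)]: by [br_all_ad] for
    positive [i], and by [br_triple0] for [i = 0]. *)
Lemma br_family_span :
  (forall P, subspace P -> (forall i, (i < m)%N -> P (e i)) ->
     (forall i x, (i < m)%N -> P x -> P [lie e i, x]) -> forall x, P x) ->
  forall x, exists c, x = \sum_p c p *: br_family p.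
Proof.
move=> gen x; apply: br_allP; apply: gen => // [i im|i y im Py].
  by apply: br_from_all; apply: (@br_fromE _ _ 0); lia.
case: i im => [|i] im; last exact: br_all_ad.
move: y Py; apply: (span_sub (P := fun y => br_all [lie e 0, y])).
  split=> [|a u v Pu Pv]; first by rewrite lie0r; apply: span_zero.
  by rewrite lie_linearr; apply: span_lin.
move=> y [Py|[i [j [im' jm ->]]]]; last exact: br_triple0.
by apply: br_all_from => //; apply: (fromS im).
Qed.

End ElectricalSpan.
(** * Rank-one calculus for the symplectic form *)

Section SympMatrices.
Variables (K : numFieldType) (n : nat).
Local Notation J := (symp_form K n).
Local Notation M := 'M[K]_(n + n).
Local Notation vec := 'cV[K]_(n + n).
Implicit Types (u w a b : vec) (X P : M).

Lemma symp_formE (i j : 'I_(n + n)) :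
  J i j = (j == i + n :> nat)%N%:R - (i == j + n :> nat)%N%:R.
Proof.
have bF (b : bool) : ~~ b -> b%:R = 0 :> K by move=> /negPf ->.
rewrite /symp_form.
case: (split_ordP i) => k ->; case: (split_ordP j) => l ->;
  have hk := ltn_ord k; have hl := ltn_ord l.
- by rewrite block_mxEul mxE /= !bF ?subr0 //; lia.
- rewrite block_mxEur mxE /= [X in _ - X]bF ?subr0; last by lia.
  by congr (_%:R); rewrite addnC eqn_add2r eq_sym.
- rewrite block_mxEdl !mxE /= [X in X - _]bF ?sub0r; last by lia.
  by congr (- _%:R); rewrite addnC eqn_add2r.
by rewrite block_mxEdr mxE /= !bF ?subr0 //; lia.
Qed.

Lemma symp_form_tr : J^T = - J.
Proof. by apply/matrixP => i j; rewrite [LHS]mxE [RHS]mxE !symp_formE opprB. Qed.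

Lemma symp_form_sq : J *m J = - 1%:M.
Proof.
rewrite /symp_form mulmx_block !mul0mx !mulmx0 !mulmxN !mulNmx !mulmx1.
by rewrite !(addr0, add0r) scalar_mx_block opp_block_mx !oppr0.
Qed.

(** The operator [x |-> omega w x *: u]. *)
Definition rank1 u w : M := u *m w^T *m J.
Definition omega u w : K := (u^T *m J *m w) 0 0.

Lemma rank1_is_linearl w : linear (rank1^~ w).
Proof. by move=> c u u'; rewrite /rank1 !mulmxDl -!scalemxAl. Qed.

Lemma rank1_is_linearr u : linear (rank1 u).
Proof.
move=> c w w'; rewrite /rank1 linearP /= mulmxDr mulmxDl.
by rewrite -scalemxAr -scalemxAl.
Qed.

Lemma omega_is_linearl w c u u' : omega (c *: u + u') w = c * omega u w + omega u' w.
Proof. by rewrite /omega linearP /= !mulmxDl -!scalemxAl !mxE. Qed.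

Lemma omegaC u w : omega w u = - omega u w.
Proof.
have -> : omega w u = (w^T *m J *m u)^T 0 0 by rewrite mxE.
by rewrite !trmx_mul trmxK symp_form_tr mulNmx mulmxN mxE mulmxA.
Qed.

Lemma omega_is_linearr u c w w' : omega u (c *: w + w') = c * omega u w + omega u w'.
Proof. by rewrite omegaC omega_is_linearl opprD -mulrN -!omegaC. Qed.

Lemma omegaB u w w' : omega u (w - w') = omega u w - omega u w'.
Proof.
have := omega_is_linearr u (-1) w' w.
by rewrite scaleN1r addrC mulN1r addrC [RHS]addrC.
Qed.

Lemma omegaxx u : omega u u = 0.
Proof.
have /eqP := omegaC u u; rewrite -addr_eq0 -mulr2n mulrn_eq0 /=.
by move/eqP.
Qed.

Lemma rank1M u w a b : rank1 u w *m rank1 a b = omega w a *: rank1 u b.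
Proof.
rewrite /rank1 -!mulmxA (mulmxA w^T) (mulmxA (w^T *m J)) [w^T *m J *m a]mx11_scalar.
by rewrite -/(omega w a) mul_scalar_mx -scalemxAr.
Qed.

Lemma rank1_mul u w a : rank1 u w *m a = omega w a *: u.
Proof.
by rewrite /rank1 -!mulmxA (mulmxA w^T) [w^T *m J *m a]mx11_scalar mul_mx_scalar.
Qed.

Lemma mxtrace_rank1 u w : \tr (rank1 u w) = omega w u.
Proof. by rewrite /rank1 -mulmxA mxtrace_mulC [X in \tr X]mx11_scalar mxtrace_scalar. Qed.

Definition commut X P : M := X *m P - P *m X.
(** Under u ⊗ w |-> [rank1 u w], the [sym2] realize the symmetric square of K^(2n), which is sp_2n,
    and the [wedge] below the exterior square, which is the space of selfadjoint matrices. *)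
Definition sym2 u w : M := rank1 u w + rank1 w u.
Definition wedge u w : M := rank1 u w - rank1 w u.

Lemma wedgeC u w : wedge w u = - wedge u w.
Proof. by rewrite /wedge opprB. Qed.

Lemma wedgexx u : wedge u u = 0.
Proof. exact: subrr. Qed.

Lemma wedge_is_linearl c u u' w : wedge (c *: u + u') w = c *: wedge u w + wedge u' w.
Proof.
by rewrite /wedge rank1_is_linearl rank1_is_linearr scalerBr opprD addrACA.
Qed.

Lemma commut_sym2_wedge u w a b : commut (sym2 u w) (wedge a b) =
  omega w a *: wedge u b - omega w b *: wedge u a
  + omega u a *: wedge w b - omega u b *: wedge w a.
Proof.
rewrite /commut /sym2 /wedge !mulmxDl !mulmxDr !mulmxN !mulNmx !rank1M.
rewrite (omegaC w b) (omegaC w a) (omegaC u b) (omegaC u a).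
move: (rank1 u a) (rank1 u b) (rank1 a u) (rank1 b u) => ? ? ? ?.
move: (rank1 w a) (rank1 w b) (rank1 a w) (rank1 b w) => ? ? ? ?.
by apply/matrixP => i j; rewrite !mxE; ring.
Qed.

Lemma commut_sym2 u w a b : commut (sym2 u w) (sym2 a b) =
  omega w a *: sym2 u b + omega w b *: sym2 u a
  + omega u a *: sym2 w b + omega u b *: sym2 w a.
Proof.
rewrite /commut /sym2 !mulmxDl !mulmxDr !rank1M.
rewrite (omegaC w b) (omegaC w a) (omegaC u b) (omegaC u a).
move: (rank1 u a) (rank1 u b) (rank1 a u) (rank1 b u) => ? ? ? ?.
move: (rank1 w a) (rank1 w b) (rank1 a w) (rank1 b w) => ? ? ? ?.
by apply/matrixP => i j; rewrite !mxE; ring.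
Qed.

Lemma commutZl c X P : commut (c *: X) P = c *: commut X P.
Proof. by rewrite /commut -scalemxAl -scalemxAr -scalerBr. Qed.

Lemma commutZr c X P : commut X (c *: P) = c *: commut X P.
Proof. by rewrite /commut -scalemxAl -scalemxAr -scalerBr. Qed.

Lemma sym2xx u : sym2 u u = 2%:R *: rank1 u u.
Proof. by rewrite scaler_nat mulr2n. Qed.

Lemma commut_rank1_wedge u a b :
  commut (rank1 u u) (wedge a b) = omega u a *: wedge u b - omega u b *: wedge u a.
Proof.
have two : 2%:R != 0 :> K by rewrite pnatr_eq0.
apply: (scalerI two); rewrite -commutZl -sym2xx commut_sym2_wedge.
by rewrite scaler_nat mulr2n addrA.
Qed.

Lemma commut_rank1 u w :
  commut (rank1 u u) (commut (rank1 u u) (rank1 w w)) =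
    (2%:R * omega u w ^+ 2) *: rank1 u u.
Proof.
have -> : commut (rank1 u u) (rank1 w w) = omega u w *: sym2 u w.
  by rewrite /commut !rank1M (omegaC u w) scaleNr opprK -scalerDr.
rewrite commutZr /commut mulmxDl mulmxDr !rank1M omegaxx (omegaC u w).
by apply/matrixP => i j; rewrite /sym2 !scale0r; move: (rank1 u u) => A; rewrite !mxE; ring.
Qed.

Lemma commut_rank1_far u w : omega u w = 0 -> commut (rank1 u u) (rank1 w w) = 0.
Proof.
by move=> uw; rewrite /commut !rank1M (omegaC u) uw oppr0 !scale0r subrr.
Qed.

(** Indexed by [nat], and zero for [k >= 2n]. *)
Definition bvec k : vec := \col_i (i == k :> nat)%:R.

Lemma bvec_big k : (n + n <= k)%N -> bvec k = 0.
Proof.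
move=> nk; apply/matrixP => i j; rewrite !mxE (_ : _ == _ = false) //.
by have := ltn_ord i; lia.
Qed.

Lemma bvec_delta (i : 'I_(n + n)) : bvec i = delta_mx i 0.
Proof. by apply/matrixP => k l; rewrite !mxE ord1 eqxx andbT. Qed.

Lemma omega_bvec i j : (i < n + n)%N -> (j < n + n)%N ->
  omega (bvec i) (bvec j) = (j == i + n)%N%:R - (i == j + n)%N%:R.
Proof.
move=> iN jN; rewrite -(symp_formE (Ordinal iN) (Ordinal jN)).
rewrite (bvec_delta (Ordinal iN)) (bvec_delta (Ordinal jN)) /omega.
by rewrite trmx_delta -rowE -colE !mxE.
Qed.

(** [b_0, b_n - b_(n+1), b_1, b_(n+1) - b_(n+2), ...], ending with [b_(2n-1)]
    because [bvec (2n) = 0]. *)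
Definition chain k : vec :=
  if odd k then bvec (n + k./2) - bvec (n + k./2).+1 else bvec k./2.

(** Even and odd chain vectors lie in two complementary Lagrangian subspaces, so only mixed parities
    pair; the odd vector b_(n+k) - b_(n+k+1) then meets just b_k and b_(k+1), its two neighbours. *)
Lemma omega_chain i j : (i < n + n)%N -> (j < n + n)%N ->
  omega (chain i) (chain j) = (j == i.+1)%:R - (i == j.+1)%:R.
Proof.
have bF (b : bool) : ~~ b -> b%:R = 0 :> K by move=> /negPf ->.
have oee k l : (k < n)%N -> (l < n)%N -> omega (bvec k) (bvec l) = 0.
  by move=> kn ln; rewrite omega_bvec ?bF ?subr0 //; lia.
(* The value [l = n] is allowed because the last odd chain vector formally contains [bvec (n + n)],
   which is 0. *)
have ofe k l : (k < n)%N -> (l <= n)%N ->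
    omega (bvec k) (bvec (n + l)) = (l == k)%:R.
  move=> kn; rewrite leq_eqVlt => /orP[/eqP->|ln].
    rewrite (@bvec_big (n + n)) // bF; last by lia.
    by have := omegaB (bvec k) 0 0; rewrite !subrr.
  rewrite omega_bvec; [|lia|lia].
  by rewrite [X in _ - X]bF ?subr0; [rewrite addnC eqn_add2r|lia].
have off k l : (k <= n)%N -> (l <= n)%N -> omega (bvec (n + k)) (bvec (n + l)) = 0.
  have o0 u : omega u 0 = 0 by have := omegaB u 0 0; rewrite !subrr.
  rewrite leq_eqVlt => /orP[/eqP->|kn].
    by rewrite (@bvec_big (n + n)) // omegaC o0 oppr0.
  rewrite leq_eqVlt => /orP[/eqP->|ln].
    by rewrite (@bvec_big (n + n)) // o0.
  by rewrite omega_bvec ?bF ?subr0 //; lia.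
have oef i' j' : (i' < n + n)%N -> (j' < n + n)%N -> ~~ odd i' -> odd j' ->
    omega (chain i') (chain j') = (j' == i'.+1)%:R - (i' == j'.+1)%:R.
  move=> iN jN io jo; rewrite /chain (negPf io) jo omegaB -addnS.
  rewrite !ofe; [|lia|lia|lia|lia].
  by congr (_%:R - _%:R); lia.
move=> iN jN; case: (boolP (odd i)) => io; case: (boolP (odd j)) => jo.
- rewrite {2}/chain jo omegaB !(omegaC (bvec _)) /chain io !omegaB -!addnS.
  rewrite !off; [|lia|lia|lia|lia|lia|lia|lia|lia].
  by rewrite !bF ?subrr ?oppr0 //; lia.
- by rewrite omegaC oef // opprB.
- exact: oef.
rewrite /chain (negPf io) (negPf jo) oee; [|lia|lia].
by rewrite !bF ?subr0 //; lia.
Qed.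

End SympMatrices.
(** * The module of traceless selfadjoint matrices *)

Section TracelessSelfAdjoint.
Variables (K : numFieldType) (n : nat).
Local Notation J := (symp_form K n).
Local Notation M := 'M[K]_(n + n).
Local Notation vec := 'cV[K]_(n + n).
Local Notation sp := (symplectic K n).
Implicit Types (u w a b : vec) (X Y : sp).

(** The matrix equation says that omega (P u, w) = omega (u, P w). *)
Definition sadj_pred : {pred M} :=
  fun P => (P^T *m J == J *m P) && (\tr P == 0).

Lemma sadj_predP (P : M) :
  reflect (P^T *m J = J *m P /\ \tr P = 0) (P \in sadj_pred).
Proof. by apply: (iffP andP) => [[/eqP ? /eqP]|[-> ->]]. Qed.

Lemma sadj_submod : submod_closed sadj_pred.
Proof.
split=> [|a P Q /sadj_predP[hP tP] /sadj_predP[hQ tQ]]; apply/sadj_predP.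
  by rewrite trmx0 mul0mx mulmx0 mxtrace0.
rewrite !linearP /= tP tQ mulr0 addr0; split=> //.
by rewrite mulmxDl -scalemxAl hP hQ.
Qed.
HB.instance Definition _ :=
  GRing.isSubmodClosed.Build K M sadj_pred sadj_submod.

Record sadj := Sadj { sadj_mx :> M; sadj_mxP : sadj_mx \in sadj_pred }.
HB.instance Definition _ := [isSub for sadj_mx].
HB.instance Definition _ := [Choice of sadj by <:].
HB.instance Definition _ := [SubChoice_isSubLmodule of sadj by <:].

Lemma symp_mul_form X : (X : M)^T *m J = - (J *m X).
Proof. by apply/eqP; rewrite -addr_eq0; apply/eqP/symp_predP/symp_mxP. Qed.

Lemma sadj_act_subproof X (P : sadj) : commut X P \in sadj_pred.
Proof.
have /sadj_predP[hP tP] := sadj_mxP P.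
apply/sadj_predP; split; last by rewrite linearB /= mxtrace_mulC subrr.
rewrite linearB /= !trmx_mul mulmxBl -!mulmxA symp_mul_form hP.
by rewrite mulmxN !mulmxA hP symp_mul_form mulNmx opprK addrC mulmxBr !mulmxA.
Qed.

Definition sadj_act X (P : sadj) : sadj := Sadj (sadj_act_subproof X P).

Lemma sadj_linearl P : linear (sadj_act^~ P).
Proof.
move=> a X Y; apply: val_inj => /=.
by rewrite /commut mulmxDl mulmxDr -scalemxAl -scalemxAr scalerBr opprD addrACA.
Qed.

Lemma sadj_linearr X : linear (sadj_act X).
Proof.
move=> a P Q; apply: val_inj => /=.
by rewrite /commut mulmxDl mulmxDr -scalemxAl -scalemxAr scalerBr opprD addrACA.
Qed.

Lemma sadj_bracket X Y P :
  sadj_act [lie X, Y] P = sadj_act X (sadj_act Y P) - sadj_act Y (sadj_act X P).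
Proof.
apply: val_inj => /=; rewrite /commut !(mulmxBl, mulmxBr) !mulmxA.
set a := X *m Y *m P; set b := X *m P *m Y; set c := Y *m X *m P.
set d := Y *m P *m X; set e := P *m X *m Y; set f := P *m Y *m X.
by apply/matrixP => i j; rewrite !mxE; ring.
Qed.

Definition sadj_rep : lie_rep sp sadj :=
  LieRep sadj_linearl sadj_linearr sadj_bracket.

Lemma rank1_tr_form u w : (rank1 u w)^T *m J = - (J *m rank1 w u).
Proof.
by rewrite /rank1 !trmx_mul trmxK symp_form_tr mulNmx mulNmx !mulmxA.
Qed.

Lemma sym2_symp u w : sym2 u w \in symp_pred (K := K) (n := n).
Proof.
apply/symp_predP; rewrite /sym2 linearD /= mulmxDl mulmxDr !rank1_tr_form.
by rewrite [- _ - _]addrC -opprD addNr.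
Qed.
Definition symp_sym2 u w : sp := Symplectic (sym2_symp u w).

Lemma rank1_symp u : rank1 u u \in symp_pred (K := K) (n := n).
Proof. by apply/symp_predP; rewrite rank1_tr_form addNr. Qed.
Definition symp_rank1 u : sp := Symplectic (rank1_symp u).

Lemma wedge_sadj u w : omega u w = 0 -> wedge u w \in sadj_pred.
Proof.
move=> uw; apply/sadj_predP; split.
  by rewrite /wedge linearB /= mulmxBl !rank1_tr_form mulmxBr opprK addrC.
by rewrite /wedge linearB /= !mxtrace_rank1 omegaC uw oppr0 addr0.
Qed.
Definition sadj_wedge u w (uw : omega u w = 0) : sadj := Sadj (wedge_sadj uw).

End TracelessSelfAdjoint.

(** * Irreducibility of the traceless selfadjoint module *)

Section Irreducible.
Variables (K : numFieldType) (n : nat).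
Local Notation J := (symp_form K n).
Local Notation M := 'M[K]_(n + n).
Local Notation vec := 'cV[K]_(n + n).
Local Notation sp := (symplectic K n).
Local Notation "''b_' k" := (bvec K n k) (at level 8, k at level 2).
Implicit Types (u w : vec) (A : M) (a b c d : 'I_(n + n)).

Lemma rank1_bvec a b : rank1 'b_a 'b_b = delta_mx a b *m J.
Proof. by rewrite /rank1 !bvec_delta trmx_delta mul_delta_mx. Qed.

(** Because J^2 = -1, A = -(A J) J; expand A J in matrix units. *)
Lemma mx_rank1_sum A : A = - (\sum_a \sum_b (A *m J) a b *: rank1 'b_a 'b_b).
Proof.
have -> : A = - (A *m J *m J) by rewrite -mulmxA symp_form_sq mulmxN mulmx1 opprK.
rewrite {1}[A *m J]matrix_sum_delta mulmx_suml; congr (- _).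
have -> : - (A *m J *m J) = A by rewrite -mulmxA symp_form_sq mulmxN mulmx1 opprK.
apply: eq_bigr => a _; rewrite mulmx_suml; apply: eq_bigr => b _.
by rewrite rank1_bvec -scalemxAl.
Qed.

(** X J is symmetric, so adding the expansion of [mx_rank1_sum] to itself with indices exchanged
    writes 2 X through the [sym2]. *)
Lemma symp_sym2_span (Q : M -> Prop) : subspace Q ->
  (forall a b, Q (sym2 'b_a 'b_b)) -> forall X : sp, Q X.
Proof.
move=> sQ Qs X; set S := (X : M) *m J.
have St : S^T = S.
  rewrite trmx_mul symp_form_tr mulNmx -[J *m _]mulmx1 -[1%:M]opprK -symp_form_sq.
  rewrite mulmxN opprK mulmxA -(mulmxA J _ J) symp_mul_form mulmxN mulNmx.
  by rewrite !mulmxA symp_form_sq !mulNmx mul1mx opprK.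
have two : 2%:R != 0 :> K by rewrite pnatr_eq0.
suff H : Q (2%:R *: (X : M)).
  rewrite -[symp_mx X]scale1r -(mulVf two) -scalerA.
  exact: subspaceZ.
have := mx_rank1_sum X; rewrite -/S scaler_nat mulr2n => ->.
rewrite [X in - _ - X]exchange_big -opprD -big_split /=.
apply: subspaceN => //; apply: subspace_sum => // a _.
rewrite -big_split; apply: subspace_sum => // b _ /=.
have Sba : S b a = S a b by rewrite -{1}St mxE.
rewrite Sba -scalerDr; apply: subspaceZ => //; exact: Qs.
Qed.

Lemma sadj_mul_form (P : sadj K n) : (P : M)^T *m J = J *m (P : M).
Proof. by case/sadj_predP: (sadj_mxP P). Qed.

(** The same doubling argument, with P J now skew-symmetric. *)
Lemma sadj_wedge_span (Q : M -> Prop) : subspace Q ->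
  (forall a b, Q (wedge 'b_a 'b_b)) -> forall P : sadj K n, Q P.
Proof.
move=> sQ Qs P; set S := (P : M) *m J.
have St : S^T = - S.
  rewrite trmx_mul symp_form_tr mulNmx -[J *m _]mulmx1 -[1%:M]opprK -symp_form_sq.
  rewrite mulmxN opprK mulmxA -(mulmxA J _ J) sadj_mul_form.
  by rewrite !mulmxA symp_form_sq !mulNmx mul1mx.
have two : 2%:R != 0 :> K by rewrite pnatr_eq0.
suff H : Q (2%:R *: (P : M)).
  rewrite -[sadj_mx P]scale1r -(mulVf two) -scalerA.
  exact: subspaceZ.
have := mx_rank1_sum P; rewrite -/S scaler_nat mulr2n => ->.
rewrite [X in - _ - X]exchange_big -opprD -big_split /=.
apply: subspaceN => //; apply: subspace_sum => // a _.
rewrite -big_split; apply: subspace_sum => // b _ /=.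
have Sba : S b a = - S a b by have : S^T a b = (- S) a b; [rewrite St | rewrite [LHS]mxE [RHS]mxE].
rewrite Sba scaleNr -scalerBr; apply: subspaceZ => //; exact: Qs.
Qed.

Lemma omega_lr (i j : 'I_n) : omega 'b_(lshift n i) 'b_(rshift n j) = (i == j)%:R :> K.
Proof.
rewrite omega_bvec ?ltn_ord //= [X in _ - X](_ : _ = 0) ?subr0; last first.
  by rewrite (_ : _ == _ = false) //; have := ltn_ord i; lia.
by rewrite addnC eqn_add2r eq_sym.
Qed.

Lemma omega_ll (i j : 'I_n) : omega 'b_(lshift n i) 'b_(lshift n j) = 0 :> K.
Proof.
have [hi hj] := (ltn_ord i, ltn_ord j).
have -> : omega 'b_(lshift n i) 'b_(lshift n j) = 0%:R - 0%:R :> K; last by rewrite subrr.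
by rewrite omega_bvec ?ltn_ord //=; congr (_%:R - _%:R); lia.
Qed.

Lemma omega_rr (i j : 'I_n) : omega 'b_(rshift n i) 'b_(rshift n j) = 0 :> K.
Proof.
have [hi hj] := (ltn_ord i, ltn_ord j).
have -> : omega 'b_(rshift n i) 'b_(rshift n j) = 0%:R - 0%:R :> K; last by rewrite subrr.
by rewrite omega_bvec ?ltn_ord //=; congr (_%:R - _%:R); lia.
Qed.

Lemma omega_rl (i j : 'I_n) : omega 'b_(rshift n i) 'b_(lshift n j) = - (i == j)%:R :> K.
Proof. by rewrite omegaC omega_lr eq_sym. Qed.

(** [b_(star a)] is the only basis vector not orthogonal to [b_a]. *)
Definition star a : 'I_(n + n) := unsplit (match split a with inl i => inr i | inr i => inl i end).

Lemma star_l (i : 'I_n) : star (lshift n i) = rshift n i.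
Proof. by rewrite /star (unsplitK (inl i)). Qed.

Lemma star_r (i : 'I_n) : star (rshift n i) = lshift n i.
Proof. by rewrite /star (unsplitK (inr i)). Qed.

Lemma starK : involutive star.
Proof. by move=> a; case: (split_ordP a) => i ->; rewrite ?(star_l, star_r). Qed.

Lemma omega_star a b : b != star a -> omega 'b_a 'b_b = 0 :> K.
Proof.
case: (split_ordP a) => i ->; case: (split_ordP b) => j ->;
  rewrite ?(star_l, star_r) ?(eq_lshift, eq_rshift) ?(omega_ll, omega_rr, omega_lr, omega_rl) //.
  by rewrite eq_sym => /negPf ->.
by rewrite eq_sym => /negPf ->; rewrite oppr0.
Qed.

Lemma omega_star_neq0 a : omega 'b_(star a) 'b_a != 0 :> K.
Proof.
by case: (split_ordP a) => i ->; rewrite ?(star_l, star_r) ?(omega_lr, omega_rl)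
  eqxx ?oppr_eq0 oner_eq0.
Qed.

Lemma commut_rank1_sadj u (P : sadj K n) :
  commut (rank1 u u) P = wedge u ((P : M) *m u).
Proof.
rewrite /commut /wedge /rank1 trmx_mul -!mulmxA; congr (_ - _).
by rewrite (sadj_mul_form P).
Qed.

Lemma omega_sadj u w (P : sadj K n) :
  omega u ((P : M) *m w) = omega ((P : M) *m u) w.
Proof.
by rewrite /omega trmx_mul -!mulmxA (mulmxA (sadj_mx P)^T J) sadj_mul_form !mulmxA.
Qed.

Lemma omega_sadjxx u (P : sadj K n) : omega u ((P : M) *m u) = 0.
Proof.
have := omega_sadj u u P; rewrite [RHS]omegaC => /eqP.
by rewrite -addr_eq0 -mulr2n mulrn_eq0 /= => /eqP.
Qed.

Lemma omega_coord c w : omega 'b_(star c) w = omega 'b_(star c) 'b_c * w c 0.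
Proof.
have oE d u : omega u 'b_d = (u^T *m J) 0 d :> K.
  by rewrite /omega bvec_delta -colE mxE.
rewrite {1}/omega mxE (bigD1 c) //= -oE big1 ?addr0 // => d dc.
by rewrite -oE omega_star ?mul0r // starK.
Qed.

Lemma wedge_comb s t u w : wedge (u + w) (s *: u + t *: w) = (t - s) *: wedge u w.
Proof.
rewrite /wedge /rank1 !linearD !linearZ /= !(mulmxDl, mulmxDr).
rewrite -!scalemxAl !mulmxDl.
move: (u *m u^T *m J) (u *m w^T *m J) (w *m u^T *m J) (w *m w^T *m J) => A B C E.
by apply/matrixP => i j; rewrite !mxE; ring.
Qed.

Lemma wedge_ll_neq0 (i j : 'I_n) : i != j ->
  wedge 'b_(lshift n i) 'b_(lshift n j) <> 0 :> M.
Proof.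
move=> ij E.
have {E} : wedge 'b_(lshift n i) 'b_(lshift n j) *m 'b_(rshift n j) = 0 :> vec.
  by rewrite E mul0mx.
rewrite mulmxBl !rank1_mul !omega_lr eqxx scale1r (negPf ij) scale0r subr0.
move/(congr1 (fun x : vec => x (lshift n i) 0)); rewrite !mxE eqxx.
by move/eqP; rewrite oner_eq0.
Qed.

(** From a nonzero element of a submodule one extracts a single wedge of two orthogonal distinct
    basis vectors, moves it to every other such wedge, then obtains the differences of the wedges of
    hyperbolic pairs. Modulo these, a selfadjoint matrix is a multiple of one hyperbolic wedge,
    which the trace excludes. *)
Lemma sadj_irreducible : (2 <= n)%N -> irreducible_rep (sadj_rep K n).
Proof.
move=> n2; have n0 : (0 < n)%N by lia.
pose i0 := Ordinal n0; pose i1 := Ordinal n2.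
have two : 2%:R != 0 :> K by rewrite pnatr_eq0.
split.
  exists (sadj_wedge (omega_ll i0 i1)); apply/eqP => /(congr1 (@sadj_mx K n)).
  exact: wedge_ll_neq0.
move=> Q [Q0 Qlin Qact]; case: (pselect (forall v, Q v -> v = 0)) => [|/existsNP[P0 /not_implyP[QP0 P0n0]]];
  [by left|right].
pose QM A := exists2 P : sadj K n, Q P & sadj_mx P = A.
have sQM : subspace QM.
  split=> [|t A B [P QP <-] [P' QP' <-]]; first by exists 0.
  by exists (t *: P + P') => //; apply: Qlin.
have QMact (X : sp) A : QM A -> QM (commut X A).
  by move=> [P QP <-]; exists (sadj_act X P) => //; apply: (Qact X).
have QM1 u A : QM A -> QM (commut (rank1 u u) A) := QMact (symp_rank1 u) A.
have QM2 u w A : QM A -> QM (commut (sym2 u w) A) := QMact (symp_sym2 u w) A.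
have QMZ t A : t != 0 -> QM (t *: A) -> QM A.
  by move=> t0 /(subspaceZ t^-1 sQM); rewrite scalerA mulVf ?scale1r.
have QMC u w : QM (wedge u w) -> QM (wedge w u).
  by move=> H; rewrite wedgeC; apply: subspaceN.
have QMP : QM P0 by exists P0.
have [a [b [ab abs QMab]]] : exists a b, [/\ a != b, b != star a & QM (wedge 'b_a 'b_b)].
  (* Transvections along [b_a] and then [b_b] isolate one off-diagonal entry
     of [P0]; for diagonal [P0], use a transvection along [b_a + b_b]. *)
  case: (pselect (exists a b, omega 'b_b 'b_a = 0 /\
      omega 'b_b ((P0 : M) *m 'b_a) <> 0)) => [[a [b [ba bPa]]]|offdiag].
    exists b, a; split.
    - by apply/eqP => ab; rewrite ab omega_sadjxx in bPa.
    - apply/eqP => ab; move/eqP: ba; rewrite ab omegaC oppr_eq0.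
      by rewrite (negPf (omega_star_neq0 _)).
    have := QM1 'b_b _ (QM1 'b_a _ QMP).
    rewrite commut_rank1_sadj commut_rank1_wedge ba scale0r sub0r -scaleNr.
    by apply: QMZ; rewrite oppr_eq0; apply/eqP.
  (* With no such off-diagonal entry, [P0] is diagonal with eigenvalues [al]. *)
  pose al a : K := ((P0 : M) *m 'b_a) a 0.
  have Pal a : (P0 : M) *m 'b_a = al a *: 'b_a.
    apply/matrixP => c j; rewrite ord1 [RHS]mxE [X in _ * X]mxE.
    have [ca|ca] := eqVneq c a; first by rewrite ca eqxx mulr1.
    rewrite val_eqE (negPf ca) mulr0; apply: contrapT => Pca.
    apply: offdiag; exists a, (star c).
    split; first by rewrite omega_star // starK eq_sym.
    rewrite omega_coord; apply/eqP; rewrite mulf_neq0 ?omega_star_neq0 //.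
    exact/eqP.
  case: (pselect (exists a b, [/\ a != b, b != star a & al a <> al b])).
    move=> [a [b [ab abs aln]]]; exists a, b; split=> //.
    have := QM1 ('b_a + 'b_b) _ QMP.
    rewrite commut_rank1_sadj mulmxDr !Pal wedge_comb; apply: QMZ.
    by rewrite subr_eq0 eq_sym; apply/eqP.
  (* Otherwise all eigenvalues coincide, so [P0] is scalar, and trace zero makes it 0. *)
  move=> aleq; case: P0n0.
  have alE a b : a != b -> b != star a -> al a = al b.
    by move=> ab abs; apply: contrapT => aln; apply: aleq; exists a, b.
  pose z := lshift n i0; pose y := lshift n i1.
  have alz a : al a = al z.
    have [->//|az] := eqVneq a z.
    have [->|asz] := eqVneq a (star z); last by apply/esym/alE => //; rewrite eq_sym.
    (* The conjugate pair z, star z is compared through a second hyperbolic pair, available since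
       [2 <= n]. *)
    transitivity (al y); last by apply: alE; rewrite ?star_l ?eq_lshift ?eq_lrshift.
    by apply: alE; rewrite ?starK ?star_l ?eq_rlshift ?eq_lshift.
  have PE : (P0 : M) = (al z)%:M.
    apply/matrixP => c a; have := congr1 (fun x : vec => x c 0) (Pal a).
    rewrite bvec_delta -colE !mxE eqxx andbT alz => ->.
    by rewrite mulr_natr.
  have /sadj_predP[_] := sadj_mxP P0; rewrite PE mxtrace_scalar.
  move/eqP; rewrite mulrn_eq0 addn_eq0 andbb (gtn_eqF n0) /= => /eqP t0.
  by apply: val_inj => /=; rewrite PE t0; apply/matrixP => i j; rewrite !mxE mul0rn.
(* Acting by [sym2] of b_c and b_(star a') replaces a' by c, up to a nonzero factor. *)
have move1 a' b' c : a' != b' -> b' != star a' -> c != star b' ->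
    QM (wedge 'b_a' 'b_b') -> QM (wedge 'b_c 'b_b').
  move=> ab' abs' cb /(QM2 'b_c 'b_(star a')).
  rewrite commut_sym2_wedge (@omega_star (star a') b') ?starK 1?eq_sym //.
  rewrite (omegaC 'b_b' 'b_c) (@omega_star b' c) //.
  rewrite oppr0 !scale0r !subr0.
  have [->|ca] := eqVneq c (star a').
    rewrite -scalerDl; apply: QMZ.
    by rewrite -mulr2n -mulr_natl mulf_neq0 ?omega_star_neq0.
  rewrite (omegaC 'b_a' 'b_c) (@omega_star a' c) // oppr0 scale0r addr0.
  by apply: QMZ; apply: omega_star_neq0.
have starC c d : (c == star d) = (d == star c).
  by rewrite -(inj_eq (inv_inj starK)) starK eq_sym.
have QMb c : c != star b -> QM (wedge 'b_c 'b_b) by move=> cb; apply: move1 QMab.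
have QMcd c d : c != b -> c != star b -> d != star c -> QM (wedge 'b_d 'b_c).
  move=> cb csb dc; apply: (@move1 b) => //; first by rewrite eq_sym.
  by apply/QMC/QMb.
have QMall c d : d != star c -> QM (wedge 'b_d 'b_c).
  move=> dc; have [cb|cb] := eqVneq c b; first by rewrite cb in dc *; apply: QMb.
  have [cb'|csb] := eqVneq c (star b); last exact: QMcd.
  have [->|dsb] := eqVneq d (star b); first by rewrite cb' wedgexx; case: sQM.
  apply: QMC; apply: QMcd => //; first by move: dc; rewrite cb' starK.
  by rewrite starC.
pose D (i : 'I_n) : M := wedge 'b_(lshift n i) 'b_(rshift n i).
have QMD i j : QM (D j - D i).
  have [->|ij] := eqVneq i j; first by rewrite subrr; case: sQM.
  have : QM (wedge 'b_(lshift n j) 'b_(rshift n i)).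
    by apply: QMall; rewrite star_r eq_lshift eq_sym.
  move/(QM2 'b_(lshift n i) 'b_(rshift n j)).
  rewrite commut_sym2_wedge !(omega_ll, omega_rr, omega_lr, omega_rl) !eqxx.
  rewrite !scale0r subr0 addr0 scale1r scaleN1r [wedge 'b_(rshift n j) _]wedgeC opprK.
  by rewrite addrC.
(* The multiple of [D i0] is eliminated at the end by taking traces. *)
pose R A := exists t, QM (A - t *: D i0).
have sR : subspace R.
  split=> [|t A B [c Hc] [d Hd]].
    by exists 0; rewrite scale0r subr0; case: sQM.
  exists (t * c + d); rewrite scalerDl -scalerA opprD addrACA -scalerBr.
  by case: sQM => _; apply.
have Rall (P : sadj K n) : R P.
  apply: (sadj_wedge_span sR) => c d.
  have [->|dc] := eqVneq c (star d); last by exists 0; rewrite scale0r subr0; apply: QMall.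
  case: (split_ordP d) => i ->; rewrite ?star_l ?star_r.
    exists (-1); rewrite scaleN1r opprK wedgeC addrC; exact: QMD.
  by exists 1; rewrite scale1r; apply: QMD.
move=> P; have [t [P' QP' E]] := Rall P.
suff t0 : t = 0.
  by move: E; rewrite t0 scale0r subr0 => /val_inj <-.
have /(congr1 mxtrace) := E; have /sadj_predP[_ ->] := sadj_mxP P'.
rewrite mxtraceD; have /sadj_predP[_ ->] := sadj_mxP P.
rewrite -scaleN1r !mxtraceZ /D /wedge mxtraceD -scaleN1r mxtraceZ !mxtrace_rank1.
rewrite omega_lr omega_rl eqxx add0r mulr1 mulN1r -opprD mulrN opprK.
move/esym/eqP; rewrite mulf_eq0.
by rewrite -(natrD _ 1 1) (negPf two) orbF => /eqP.
Qed.

End Irreducible.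
(** * Irreducible highest weight modules *)

Section HighestWeightVectors.
Variables (K : numFieldType) (n : nat).
Local Notation J := (symp_form K n).
Local Notation M := 'M[K]_(n + n).
Local Notation vec := 'cV[K]_(n + n).
Local Notation sp := (symplectic K n).
Local Notation "''b_' k" := (bvec K n k) (at level 8, k at level 2).
Implicit Types X : sp.

Lemma commut_symp_sym2 X (u w : vec) :
  commut X (sym2 u w) = sym2 ((X : M) *m u) w + sym2 u ((X : M) *m w).
Proof.
have JX : J *m X = - ((X : M)^T *m J) by rewrite symp_mul_form opprK.
rewrite /commut /sym2 /rank1 mulmxDr mulmxDl -!mulmxA JX !mulmxN !trmx_mul !mulmxA.
by rewrite opprD !opprK [X in _ + X]addrC addrACA [X in _ + X]addrC.
Qed.

Lemma sym2_bvecE (a b c d : 'I_(n + n)) : sym2 'b_a 'b_b c d =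
  (c == a)%:R * omega 'b_b 'b_d + (c == b)%:R * omega 'b_a 'b_d :> K.
Proof.
have r1 (x y : 'I_(n + n)) : rank1 'b_x 'b_y c d = (c == x)%:R * omega 'b_y 'b_d :> K.
  rewrite /rank1 -mulmxA mxE big_ord1 mxE val_eqE; congr (_ * _).
  by rewrite /omega (bvec_delta K d) -colE [RHS]mxE.
by rewrite mxE !r1.
Qed.

Lemma sym2_lr_diag (i : 'I_n) : is_diag_mx (sym2 'b_(lshift n i) 'b_(rshift n i) : M).
Proof.
apply/is_diag_mxP => c d cd; rewrite sym2_bvecE.
have [ci|_] := eqVneq c (lshift n i).
  have [E|_] := eqVneq c (rshift n i); first by move: E; rewrite ci => /eqP; rewrite eq_lrshift.
  by rewrite omega_star ?mulr0 ?mul0r ?addr0 // star_r -ci eq_sym.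
rewrite mul0r add0r; have [ci|_] := eqVneq c (rshift n i); last by rewrite mul0r.
by rewrite omega_star ?mulr0 // star_l -ci eq_sym.
Qed.

Lemma ulsubmxE (A : M) (i j : 'I_n) : ulsubmx A i j = A (lshift n i) (lshift n j).
Proof. by rewrite !mxE. Qed.

Lemma dlsubmxE (A : M) (i j : 'I_n) : dlsubmx A i j = A (rshift n i) (lshift n j).
Proof. by rewrite !mxE. Qed.

Lemma sym2_ll_nilpos (i j : 'I_n) :
  symp_nilpos (symp_sym2 'b_(lshift n i) 'b_(lshift n j) : sp).
Proof.
split=> [p q _|].
  by rewrite ulsubmxE [LHS]sym2_bvecE !omega_ll !mulr0 addr0.
by apply/matrixP => p q; rewrite dlsubmxE [RHS]mxE [LHS]sym2_bvecE !omega_ll !mulr0 addr0.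
Qed.

Lemma sym2_lr_nilpos (i j : 'I_n) : (i < j)%N ->
  symp_nilpos (symp_sym2 'b_(lshift n i) 'b_(rshift n j) : sp).
Proof.
move=> ij; split=> [p q qp|].
  rewrite ulsubmxE [LHS]sym2_bvecE omega_ll mulr0 addr0 omega_rl eq_lshift.
  have [pi|_] := eqVneq p i; last by rewrite mul0r.
  have [jq|_] := eqVneq j q; last by rewrite oppr0 mulr0.
  by move: ij qp; rewrite pi jq; lia.
apply/matrixP => p q; rewrite dlsubmxE [RHS]mxE [LHS]sym2_bvecE omega_ll mulr0 addr0.
by rewrite eq_rlshift mul0r.
Qed.

(** The diagonal matrix [diag (n, ..., 1, - n, ..., - 1)]. *)
Definition grading : sp :=
  - \sum_(i < n) (n - i)%:R *: symp_sym2 'b_(lshift n i) 'b_(rshift n i).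

Lemma symp_mx_sum (I : Type) (r : seq I) (F : I -> sp) :
  symp_mx (\sum_(i <- r) F i) = \sum_(i <- r) symp_mx (F i).
Proof. by elim/big_rec2: _ => // i A X _ <-. Qed.

Lemma gradingE :
  grading = - \sum_(i < n) (n - i)%:R *: sym2 'b_(lshift n i) 'b_(rshift n i) :> M.
Proof. by rewrite /grading [LHS]/= symp_mx_sum. Qed.

Lemma grading_cartan : symp_cartan grading.
Proof.
apply/is_diag_mxP => c d cd; rewrite gradingE mxE summxE big1 ?oppr0 // => i _.
by rewrite mxE; have /is_diag_mxP -> := sym2_lr_diag i; rewrite ?mulr0.
Qed.

Definition grade (a : 'I_(n + n)) : K :=
  match split a with inl i => (n - i)%:R | inr i => - (n - i)%:R end.

Lemma grade_l (i : 'I_n) : grade (lshift n i) = (n - i)%:R.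
Proof. by rewrite /grade (unsplitK (inl i)). Qed.

Lemma grade_r (i : 'I_n) : grade (rshift n i) = - (n - i)%:R.
Proof. by rewrite /grade (unsplitK (inr i)). Qed.

Lemma grading_bvec (a : 'I_(n + n)) : (grading : M) *m 'b_a = grade a *: 'b_a.
Proof.
rewrite gradingE mulNmx mulmx_suml; case: (split_ordP a) => j ->.
  rewrite (bigD1 j) //= big1 => [|i ij].
    rewrite addr0 -scalemxAl mulmxDl !rank1_mul omega_rl omega_ll eqxx scale0r addr0.
    by rewrite grade_l scaleN1r scalerN opprK.
  rewrite -scalemxAl mulmxDl !rank1_mul omega_rl omega_ll (negPf ij) oppr0.
  by rewrite !scale0r addr0 scaler0.
rewrite (bigD1 j) //= big1 => [|i ij].
  rewrite addr0 -scalemxAl mulmxDl !rank1_mul omega_rr omega_lr eqxx scale0r add0r.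
  by rewrite grade_r scale1r scaleNr.
rewrite -scalemxAl mulmxDl !rank1_mul omega_rr omega_lr (negPf ij).
by rewrite !scale0r addr0 scaler0.
Qed.

Lemma grading_sym2 (a b : 'I_(n + n)) : [lie grading, symp_sym2 'b_a 'b_b] =
  (grade a + grade b) *: symp_sym2 'b_a 'b_b.
Proof.
apply: val_inj; apply: (etrans (commut_symp_sym2 _ _ _)); rewrite !grading_bvec [RHS]/=.
rewrite /sym2 /rank1 !linearZ /= -!scalemxAl -!scalerDr.
by rewrite -scalerDl.
Qed.

(** * The module generated by a highest weight vector *)

Section Module.
Variables (V : lmodType K) (rho : lie_rep sp V) (mu : sp -> K) (v : V).

Inductive generated : V -> Prop :=
| generated_gen : generated v
| generated_zero : generated 0
| generated_lin (a : K) u w of generated u & generated w : generated (a *: u + w)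
| generated_act X w of generated w : generated (rho X w).

Lemma generated_stable : rep_stable rho generated.
Proof.
by split; [apply: generated_zero | apply: generated_lin | apply: generated_act].
Qed.

Lemma generated_min (P : V -> Prop) : rep_stable rho P -> P v ->
  forall w, generated w -> P w.
Proof.
move=> [P0 lP aP] Pv w; elim=> {w} // [a u w _ Pu _ Pw|X w _ Pw].
  exact: lP.
exact: aP.
Qed.

(** [grading] is positive on every positive root, so a negative integer eigenvalue of [ad grading]
    picks out combinations of negative root vectors. *)
Definition lowering (Y : sp) : Prop :=
  exists k : nat, [lie grading, Y] = - k.+1%:R *: Y.

(** The orbit of [v] under the enveloping algebra of the lowering part. *)
Inductive lowered : V -> Prop :=
| lowered_gen : lowered v
| lowered_zero : lowered 0
| lowered_lin (a : K) u w of lowered u & lowered w : lowered (a *: u + w)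
| lowered_act Y w of lowering Y & lowered w : lowered (rho Y w).

Lemma symp_sym2_trichotomy (a b : 'I_(n + n)) (X := symp_sym2 'b_a 'b_b : sp) :
  [\/ lowering X, symp_cartan X | symp_nilpos X].
Proof.
have symC c d : symp_sym2 'b_c 'b_d = symp_sym2 'b_d 'b_c :> sp.
  by apply: val_inj; rewrite /= /sym2 addrC.
have lr (i j : 'I_n) (Y := symp_sym2 'b_(lshift n i) 'b_(rshift n j) : sp) :
    [\/ lowering Y, symp_cartan Y | symp_nilpos Y].
  rewrite {}/Y; case: (ltngtP i j) => ij.
  - by apply: Or33; apply: sym2_lr_nilpos.
  - apply: Or31; exists (i - j).-1; rewrite grading_sym2 grade_l grade_r.
    rewrite -opprB -natrB; last by have := ltn_ord i; lia.
    by congr (- _%:R *: _); have := ltn_ord i; lia.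
  by apply: Or32; rewrite (val_inj ij); apply: sym2_lr_diag.
rewrite {}/X; case: (split_ordP a) => i ->; case: (split_ordP b) => j ->.
- by apply: Or33; apply: sym2_ll_nilpos.
- exact: lr.
- by rewrite symC; apply: lr.
apply: Or31; exists (n - i + (n - j)).-1; rewrite grading_sym2 !grade_r.
rewrite -opprD -natrD; congr (- _%:R *: _); have := ltn_ord i; lia.
Qed.

Hypothesis v_hw : highest_weight_vector rho mu v.

(** A substitute for the Poincaré-Birkhoff-Witt theorem: X Y w = [X, Y] w + Y X w moves any X past
    the lowering operators until it reaches [v], where it lowers, scales or kills. *)
Lemma lowered_stable X w : lowered w -> lowered (rho X w).
Proof.
move=> lw; elim: lw X => {w} [||a u w _ IHu _ IHw|Y w lY lw IHw] X.
- have [Y /val_inj <- //] : exists2 Y : sp, symp_mx Y = X & lowered (rho Y v).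
  apply: (symp_sym2_span (Q := fun A => exists2 Y : sp, symp_mx Y = A & lowered (rho Y v))).
    split=> [|a A B [Y <- lY] [Z <- lZ]].
      by exists 0 => //; rewrite -(scale0r 0) repZl scale0r; apply: lowered_zero.
    exists (a *: Y + Z) => //; rewrite (rep_linearl rho); exact: lowered_lin.
  move=> a b; exists (symp_sym2 'b_a 'b_b) => //.
  have [_ v_nil v_wt] := v_hw.
  case: (symp_sym2_trichotomy a b) => [lX|cX|nX].
  + exact/lowered_act/lowered_gen.
  + rewrite v_wt // -[_ *: v]addr0.
    by apply: lowered_lin; [apply: lowered_gen | apply: lowered_zero].
  + by rewrite v_nil //; apply: lowered_zero.
- by rewrite rep0; apply: lowered_zero.
- by rewrite (rep_linearr rho); apply: lowered_lin.
have -> : rho X (rho Y w) = 1 *: rho [lie X, Y] w + rho Y (rho X w).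
  by rewrite rep_bracket scale1r subrK.
by apply: lowered_lin => //; apply: lowered_act.
Qed.

Lemma generated_lowered w : generated w -> lowered w.
Proof.
apply: generated_min; last exact: lowered_gen.
split; [exact: lowered_zero | exact: lowered_lin |].
by move=> X u; apply: lowered_stable.
Qed.

(** Sums of [grading] eigenvectors whose eigenvalues are m minus a positive integer. *)
Inductive below (m : K) : V -> Prop :=
| below_zero : below m 0
| below_lin (a : K) u w of below m u & below m w : below m (a *: u + w)
| below_eig (k : nat) w of rho grading w = (m - k.+1%:R) *: w : below m w.

Lemma lowering_shift Y k c w : [lie grading, Y] = - k.+1%:R *: Y ->
  rho grading w = c *: w -> rho grading (rho Y w) = (c - k.+1%:R) *: rho Y w.
Proof.
move=> Yk wc; have /eqP := rep_bracket rho grading Y w.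
rewrite Yk repZl wc repZr eq_sym subr_eq => /eqP ->.
by rewrite scalerBl scaleNr addrC.
Qed.

Lemma below_act m Y w : lowering Y -> below m w -> below m (rho Y w).
Proof.
move=> [k Yk]; elim=> {w} [|a u w _ IHu _ IHw|j w wj].
- by rewrite rep0; apply: below_zero.
- by rewrite (rep_linearr rho); apply: below_lin.
apply: (@below_eig _ (j + k).+1); rewrite (lowering_shift Yk wj).
by rewrite -addrA -opprD -natrD addSn addnS.
Qed.

(** The operator prod over j = 1, ..., N of (grading - (m - j)): it separates the eigenvalue m from
    those below without an eigenspace decomposition. *)
Fixpoint shifted_prod (m : K) N w : V :=
  if N is N'.+1 then
    let x := shifted_prod m N' w in rho grading x - (m - N%:R) *: x
  else w.

Lemma shifted_prod_lin m N a u w : shifted_prod m N (a *: u + w) =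
  a *: shifted_prod m N u + shifted_prod m N w.
Proof.
elim: N => //= N ->; rewrite (rep_linearr rho) scalerBr [_ *: (_ + _)]scalerDr.
by rewrite opprD addrACA !scalerA [a * _]mulrC.
Qed.

Lemma shifted_prod_eig m N c w : rho grading w = c *: w ->
  shifted_prod m N w = (\prod_(j < N) (c - (m - j.+1%:R))) *: w.
Proof.
move=> wc; elim: N => [|N IHN] /=; first by rewrite big_ord0 scale1r.
by rewrite IHN repZr wc !scalerA -scalerBl big_ord_recr /= mulrBr [X in _ - X]mulrC.
Qed.

Lemma below_shifted m w : below m w -> exists N, forall N', (N <= N')%N -> shifted_prod m N' w = 0.
Proof.
have s0 N : shifted_prod m N 0 = 0 by rewrite (@shifted_prod_eig _ _ 0) ?rep0 ?scaler0.
elim=> {w} [|a u w _ [N HN] _ [N' HN']|k w wk].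
- by exists 0%N => N _; rewrite s0.
- exists (maxn N N') => k; rewrite geq_max => /andP[Nk Nk'].
  by rewrite shifted_prod_lin HN // HN' // scaler0 addr0.
exists k.+1 => N kN; rewrite (shifted_prod_eig _ _ wk).
by rewrite (bigD1 (Ordinal kN)) //= subrr mul0r scale0r.
Qed.

(** For large N the product kills [w], while on the eigenvalue m it acts by N!, nonzero in
    characteristic 0. *)
Lemma below_eq0 m w : below m w -> rho grading w = m *: w -> w = 0.
Proof.
move=> /below_shifted[N /(_ N (leqnn N))] + wm.
rewrite (shifted_prod_eig _ _ wm) => /eqP; rewrite scaler_eq0 prodf_seq_eq0.
case/orP => [/hasP[j _] /=|/eqP //].
by rewrite opprB addrC subrK pnatr_eq0.
Qed.

Lemma generated_top w : generated w ->
  exists c, below (mu grading) (w - c *: v).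
Proof.
have [_ _ v_wt] := v_hw; have vE := v_wt _ grading_cartan.
move/generated_lowered; elim=> {w} [||a u w _ [c Hc] _ [d Hd]|Y w lY _ [c Hc]].
- by exists 1; rewrite scale1r subrr; apply: below_zero.
- by exists 0; rewrite scale0r subrr; apply: below_zero.
- exists (a * c + d); rewrite scalerDl -scalerA opprD addrACA -scalerBr.
  exact: below_lin.
exists 0; rewrite scale0r subr0; have [k Yk] := lY.
have -> : rho Y w = c *: rho Y v + rho Y (w - c *: v).
  by rewrite -(rep_linearr rho) addrC subrK.
apply: below_lin; last exact: below_act.
by apply: (@below_eig _ k); apply: lowering_shift.
Qed.

Lemma generated_top_weight w : generated w ->
  rho grading w = mu grading *: w -> exists c, w = c *: v.
Proof.
have [_ _ v_wt] := v_hw; have vE := v_wt _ grading_cartan.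
move=> /generated_top[c Hc] wE; exists c; apply/eqP; rewrite -subr_eq0; apply/eqP.
apply: below_eq0 Hc _.
rewrite addrC -scaleNr (rep_linearr rho) vE wE scalerDr !scalerA.
by rewrite [mu _ * _]mulrC.
Qed.

End Module.

Lemma highest_weight_unique (V1 V2 : lmodType K) (rho1 : lie_rep sp V1)
    (rho2 : lie_rep sp V2) (mu : sp -> K) :
  irreducible_highest_weight rho1 mu -> irreducible_highest_weight rho2 mu ->
  exists f : V1 -> V2, [/\ linear f, bijective f &
    forall X w, f (rho1 X w) = rho2 X (f w)].
Proof.
move=> [[_ irr1] [v1 [v1n0 v1nil v1wt]]] [[_ irr2] [v2 [v2n0 v2nil v2wt]]].
pose rho := rep_sum rho1 rho2; pose G := generated rho (v1, v2).
have [G0 Glin Gact] : rep_stable rho G by apply: generated_stable.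
have hw : highest_weight_vector rho mu (v1, v2).
  split=> [|X nX|H cH].
  - by apply: contra v1n0 => /eqP[-> _].
  - by rewrite /= /rep_sum_act /= v1nil // v2nil.
  by rewrite /= /rep_sum_act /= v1wt // v2wt.
have Gtop w : G w -> rho (grading) w = mu grading *: w -> exists c, w = c *: (v1, v2).
  by move=> Gw E; exact: (generated_top_weight hw Gw E).
(* These [w2] form a submodule of [V2]. If it were everything, (0, v2) would be a vector of top
   weight in [G], hence a multiple of (v1, v2), contradicting that both entries are nonzero. *)
have G1 w2 : G (0, w2) -> w2 = 0.
  have [|H|H] := irr2 (fun w => G (0, w)); last 2 first.
  - exact: H.
  - have [|c [/esym/eqP + E]] := Gtop _ (H v2).
      by congr pair; rewrite /= ?rep0 ?scaler0 // v2wt //; apply: grading_cartan.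
    rewrite scaler_eq0 (negPf v1n0) orbF => /eqP c0.
    by move: v2n0; rewrite E c0 scale0r eqxx.
  split=> // [a u w Gu Gw|X w Gw].
    by have := Glin a _ _ Gu Gw; rewrite /= (_ : _ + _ = (0, a *: u + w)) //; congr pair; rewrite /= scaler0 addr0.
  by have := Gact X _ Gw; rewrite /= /rep_sum_act /= rep0.
have G2 w1 : G (w1, 0) -> w1 = 0.
  have [|H|H] := irr1 (fun w => G (w, 0)); last 2 first.
  - exact: H.
  - have [|c [E /esym/eqP]] := Gtop _ (H v1).
      by congr pair; rewrite /= ?rep0 ?scaler0 // v1wt //; apply: grading_cartan.
    rewrite scaler_eq0 (negPf v2n0) orbF => /eqP c0.
    by move: v1n0; rewrite E c0 scale0r eqxx.
  split=> // [a u w Gu Gw|X w Gw].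
    by have := Glin a _ _ Gu Gw; rewrite /= (_ : _ + _ = (a *: u + w, 0)) //; congr pair; rewrite /= scaler0 addr0.
  by have := Gact X _ Gw; rewrite /= /rep_sum_act /= rep0.
have Gv : G (v1, v2) by apply: generated_gen.
(* The projections of [G] are submodules containing the highest weight vectors, hence are
   everything; with [G1] and [G2] this makes [G] the graph of a bijection. *)
have tot1 w1 : exists w2, G (w1, w2).
  have [|H|//] := irr1 (fun w => exists w2, G (w, w2)).
    split=> [|a u w [u2 Gu] [w2 Gw]|X w [w2 Gw]]; first by exists 0.
      by exists (a *: u2 + w2); apply: Glin Gu Gw.
    by exists (rho2 X w2); apply: (Gact X) Gw.
  by move: v1n0; rewrite (H v1) ?eqxx //; exists v2.
have tot2 w2 : exists w1, G (w1, w2).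
  have [|H|//] := irr2 (fun w => exists w1, G (w1, w)).
    split=> [|a u w [u2 Gu] [w1 Gw]|X w [w1 Gw]]; first by exists 0.
      by exists (a *: u2 + w1); apply: Glin Gu Gw.
    by exists (rho1 X w1); apply: (Gact X) Gw.
  by move: v2n0; rewrite (H v2) ?eqxx //; exists v1.
have GB u w : G u -> G w -> G (u - w).
  by move=> Gu Gw; rewrite addrC -scaleN1r; apply: Glin.
have [f Gf] := choice tot1; have [g Gg] := choice tot2.
have fun1 w1 w2 : G (w1, w2) -> w2 = f w1.
  move=> Gw; apply/eqP; rewrite -subr_eq0; apply/eqP/G1.
  by have := GB _ _ Gw (Gf w1); rewrite (_ : _ - _ = (0, w2 - f w1)) //; congr pair; rewrite /= subrr.
have fun2 w1 w2 : G (w1, w2) -> w1 = g w2.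
  move=> Gw; apply/eqP; rewrite -subr_eq0; apply/eqP/G2.
  by have := GB _ _ Gw (Gg w2); rewrite (_ : _ - _ = (w1 - g w2, 0)) //; congr pair; rewrite /= subrr.
exists f; split=> [a u w||X w].
- by apply/esym/fun1; apply: Glin (Gf u) (Gf w).
- by exists g => w; [rewrite -(fun2 _ _ (Gf w)) | rewrite -(fun1 _ _ (Gg w))].
by apply/esym/fun1; apply: (Gact X) (Gf w).
Qed.

End HighestWeightVectors.

(** * The highest weight of the concrete module *)

Section SadjHighestWeight.
Variables (K : numFieldType) (n : nat).
Local Notation J := (symp_form K n).
Local Notation M := 'M[K]_(n + n).
Local Notation vec := 'cV[K]_(n + n).
Local Notation sp := (symplectic K n).
Local Notation "''b_' k" := (bvec K n k) (at level 8, k at level 2).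
Implicit Types (u w : vec) (X : sp).

Lemma commut_symp_wedge X u w :
  commut X (wedge u w) = wedge ((X : M) *m u) w + wedge u ((X : M) *m w).
Proof.
have JX : J *m X = - ((X : M)^T *m J) by rewrite symp_mul_form opprK.
rewrite /commut /wedge /rank1 mulmxBr mulmxBl -!mulmxA JX !mulmxN !trmx_mul !mulmxA.
move: (X *m u *m _ *m J) (X *m w *m _ *m J) => A B.
move: (u *m _ *m _ *m J) (w *m _ *m _ *m J) => C D.
by apply/matrixP => i j; rewrite !mxE; ring.
Qed.

Lemma sadj_highest_weight : (2 <= n)%N ->
  irreducible_highest_weight (sadj_rep K n) (@symp_lambda K n).
Proof.
move=> n2; split; first exact: sadj_irreducible.
have n1 : (0 < n)%N by lia.
have [i0 i00] : exists i : 'I_n, i = 0%N :> nat by exists (Ordinal n1).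
have [i1 i11] : exists i : 'I_n, i = 1%N :> nat by exists (Ordinal n2).
have i01 : i0 != i1 by rewrite -val_eqE /= i00 i11.
have colE' X a : (X : M) *m 'b_(a : 'I_(n + n)) = \sum_c X c a *: 'b_c.
  apply/matrixP => d j; rewrite ord1 bvec_delta -colE mxE summxE (bigD1 d) //=.
  rewrite bvec_delta !mxE !eqxx mulr1 big1 ?addr0 // => c cd.
  by rewrite bvec_delta !mxE eq_sym (negPf cd) mulr0.
(* The highest weight vector is the wedge of b_0 and b_1: an element of the nilradical kills b_0 and
   sends b_1 to a multiple of b_0. *)
exists (sadj_wedge (omega_ll K i0 i1)); split.
- apply/eqP => /(congr1 (@sadj_mx K n)); exact: wedge_ll_neq0.
- move=> X [upper dl0]; apply: val_inj; apply: (etrans (commut_symp_wedge _ _ _)).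
  have dl i j : (X : M) (rshift n i) (lshift n j) = 0.
    by rewrite -dlsubmxE dl0 mxE.
  have ul (i j : 'I_n) : (j <= i)%N -> (X : M) (lshift n i) (lshift n j) = 0.
    by move=> ji; rewrite -ulsubmxE upper.
  have -> : (X : M) *m 'b_(lshift n i0) = 0.
    rewrite colE' big_split_ord /= !big1 ?addr0 // => i _.
      by rewrite dl scale0r.
    by rewrite ul ?scale0r ?i00.
  have -> : (X : M) *m 'b_(lshift n i1) = X (lshift n i0) (lshift n i1) *: 'b_(lshift n i0).
    rewrite colE' big_split_ord /= [X in _ + X]big1 => [|i _]; last by rewrite dl scale0r.
    rewrite (bigD1 i0) //= big1 ?addr0 // => i ii0.
    rewrite ul ?scale0r // i11 lt0n; apply: contra ii0 => /eqP i_0.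
    by apply/eqP/val_inj; rewrite /= i_0 i00.
  rewrite wedgeC (_ : wedge _ 0 = 0) ?oppr0 ?add0r; last first.
    by rewrite /wedge /rank1 trmx0 mulmx0 !mul0mx subrr.
  rewrite wedgeC -[X in wedge X _]addr0 wedge_is_linearl wedgexx scaler0 add0r.
  by rewrite /wedge /rank1 trmx0 mulmx0 !mul0mx subrr oppr0.
move=> H /is_diag_mxP Hd; apply: val_inj; apply: (etrans (commut_symp_wedge _ _ _)).
have Hb a : (H : M) *m 'b_(a : 'I_(n + n)) = H a a *: 'b_a.
  rewrite colE' (bigD1 a) //= big1 ?addr0 // => c ca.
  by rewrite Hd ?scale0r // val_eqE.
have w0 u : wedge 0 u = 0 by rewrite /wedge /rank1 trmx0 mulmx0 !mul0mx subrr.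
rewrite !Hb -[X in wedge X _ + _]addr0 wedge_is_linearl w0 addr0.
rewrite [X in _ + X]wedgeC -[X in _ - wedge X _]addr0 wedge_is_linearl w0 addr0.
rewrite -scalerN -wedgeC -scalerDl; congr (_ *: _).
rewrite /symp_lambda /symp_weight (big_pred1 i0) => [|i]; last first.
  by rewrite -[RHS]val_eqE /= i00 eqSS.
by rewrite (big_pred1 i1) // => i; rewrite -[RHS]val_eqE /= i11 eqSS.
Qed.

End SadjHighestWeight.
(** * The isomorphism *)

Section PresentedGeneration.
Variables (K : fieldType) (X : Type) (rel : lie_term K X -> lie_term K X -> Prop).
Local Notation L := (presented_lie rel).

Lemma presented_lie_ind (P : L -> Prop) : subspace P ->
  (forall i, P (pl_gen rel i)) ->
  (forall i x, P x -> P [lie pl_gen rel i, x]) -> forall x, P x.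
Proof.
move=> sP Pg Pad; elim/lie_class_ind => t.
(* Strengthened to cover brackets: the action of a bracket is a commutator of actions. *)
suff [] : P (lie_class rel t) /\ forall x, P x -> P [lie lie_class rel t, x] by [].
elim: t => [i||s [Ps as_] t [Pt at_]|a s [Ps as_]|s [Ps as_] t [Pt at_]].
- by split; [apply: Pg | apply: Pad].
- have -> : lie_class rel LZero = 0 by [].
  by case: sP => P0 _; split=> // x _; rewrite lie0l.
- rewrite lie_classD; split; first exact: subspaceD.
  by move=> x Px; rewrite lieDl; apply: subspaceD; auto.
- rewrite lie_classZ; split; first exact: subspaceZ.
  by move=> x Px; rewrite lieZl; apply: subspaceZ; auto.
rewrite lie_class_bracket; split; first exact: as_.
by move=> x Px; rewrite lie_lie; apply: subspaceB; auto.
Qed.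

End PresentedGeneration.

Lemma electricalC_span (K : numFieldType) (m : nat) :
  exists x : 'I_m * 'I_m -> electricalC K m,
    forall y, exists c, y = \sum_p c p *: x p.
Proof.
pose L := electricalC K m; pose rel := @electricalC_rel K m.
(* Generators are indexed by [nat], with value 0 from [m] on. *)
pose e k : L := if insub k is Some i then pl_gen rel i else 0.
have eE (i : 'I_m) : e i = pl_gen rel i by rewrite /e valK.
have class0 : lie_class rel LZero = 0 by [].
have brE s t : [lie (lie_class rel s : L), lie_class rel t] = lie_class rel (LBracket s t).
  by rewrite -lie_class_bracket.
have gE i (im : (i < m)%N) : e i = lie_class rel (LGen (Ordinal im)).
  exact: (eE (Ordinal im)).
exists (br_family e); apply: br_family_span.
- move=> i j im jm ij; rewrite !gE brE -class0; apply/lie_classP/lc_rel.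
  exact: elC_far.
- move=> i j /andP[i0 im] jm ij.
  rewrite !gE (brE (LGen _) (LGen _)) (brE (LGen _) (LBracket (LGen _) _)).
  rewrite -[RHS]lie_classZ; apply/lie_classP/lc_rel.
  by apply: elC_adj; rewrite /= ij -lt0n.
- move=> m1; have m0 : (0 < m)%N by lia.
  rewrite !gE (brE (LGen _) (LGen _)) (brE (LGen _) (LBracket (LGen _) (LGen _))).
  rewrite (brE (LGen _) (LBracket (LGen _) (LBracket (LGen _) _))) -class0.
  by apply/lie_classP/lc_rel/elC_first.
move=> P sP Pe Pad; apply: presented_lie_ind => // [i|i x Px].
  by rewrite -eE; apply: Pe.
by rewrite -eE; apply: Pad.
Qed.

(** Dimension count: the images of the spanning family form a square matrix of full rank, so its
    rows are independent and the coefficients of a kernel element vanish. *)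
Lemma surj_span_inj (K : fieldType) (L : lmodType K) (I : finType) (N : nat)
    (x : I -> L) (h : {linear L -> 'M[K]_N}) :
  #|I| = (N * N)%N -> (forall y, exists c : I -> K, y = \sum_i c i *: x i) ->
  (forall A, exists y, h y = A) -> injective h.
Proof.
move=> cardI x_span h_surj.
pose B : 'M[K]_(#|I|, N * N) := \matrix_k mxvec (h (x (enum_val k))).
have hB (c : I -> K) : mxvec (h (\sum_i c i *: x i)) = (\row_k c (enum_val k)) *m B.
  rewrite !linear_sum mulmx_sum_row (reindex (enum_val (A := I))) /=.
    by apply: eq_bigr => k _; rewrite !linearZ rowK mxE.
  exact: onW_bij (enum_val_bij I).
have fullB : row_full B.
  rewrite -sub1mx; apply/row_subP => k.
  have [y hy] := h_surj (vec_mx (row k 1%:M)).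
  have [c yc] := x_span y; rewrite -[row k _]vec_mxK -hy yc hB.
  exact: submxMl.
have freeB : row_free B by rewrite /row_free (eqP fullB) -cardI.
have h0 y : h y = 0 -> y = 0.
  have [c ->] := x_span y => hy; rewrite big1 // => i _.
  have : (\row_k c (enum_val k)) *m B = 0 *m B by rewrite mul0mx -hB hy linear0.
  move/(row_free_inj freeB)/rowP/(_ (enum_rank i)).
  by rewrite !mxE enum_rankK => ->; rewrite scale0r.
move=> y z yz; apply/eqP; rewrite -subr_eq0; apply/eqP/h0.
by rewrite linearB /= yz subrr.
Qed.

(** * The electrical generators inside the semidirect product *)

Section ElectricalModel.
Variables (K : numFieldType) (n : nat).
Hypothesis n2 : (2 <= n)%N.
Local Notation J := (symp_form K n).
Local Notation M := 'M[K]_(n + n).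
Local Notation vec := 'cV[K]_(n + n).
Local Notation sp := (symplectic K n).
Local Notation "''b_' k" := (bvec K n k) (at level 8, k at level 2).
Local Notation v k := (chain K n k).
Local Notation rho0 := (sadj_rep K n).
Local Notation rho := (rep_sum (sadj_rep K n) (rep_trivial sp K^o)).
Local Notation S := (semidirect rho).
Implicit Types (X Y : sp) (p q : sadj K n).

(** Neighbours carry opposite signs, which turns the coefficient 2 omega^2 of [commut_rank1] into
    the required -2. *)
Definition sp_gen k : sp := (-1) ^+ k *: symp_rank1 (v k).

Lemma sp_genE k : sp_gen k = (-1) ^+ k *: rank1 (v k) (v k) :> M.
Proof. by []. Qed.

Lemma sp_gen_far i j : (i < n + n)%N -> (j < n + n)%N ->
  (i.+1 < j)%N || (j.+1 < i)%N -> [lie sp_gen i, sp_gen j] = 0.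
Proof.
move=> im jm ij; rewrite /sp_gen lieZl lieZr; apply: val_inj.
apply: (etrans (y := (-1) ^+ i *: ((-1) ^+ j *: commut (rank1 (v i) (v i)) (rank1 (v j) (v j))))) => //.
rewrite commut_rank1_far ?scaler0 // omega_chain //.
have -> : (j == i.+1) = false by lia.
have -> : (i == j.+1) = false by lia.
exact: subrr.
Qed.

Lemma sp_gen_adj i j : (i < n + n)%N -> (j < n + n)%N ->
  (i.+1 == j) || (j.+1 == i) ->
  [lie sp_gen i, [lie sp_gen i, sp_gen j]] = (- 2%:R) *: sp_gen i.
Proof.
move=> im jm ij; apply: val_inj.
have -> : val [lie sp_gen i, [lie sp_gen i, sp_gen j]]
    = commut (sp_gen i) (commut (sp_gen i) (sp_gen j)) by [].
have -> : val (- 2%:R *: sp_gen i) = - 2%:R *: symp_mx (sp_gen i) by [].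
rewrite !sp_genE !commutZl !commutZr commut_rank1 omega_chain // !scalerA.
congr (_ *: _); case/orP: ij => /eqP <-.
  rewrite eqxx (_ : (_ == _) = false) ?subr0; last by lia.
  rewrite expr1n mulr1 exprS; have : (-1) ^+ i * (-1) ^+ i = 1 :> K by rewrite -expr2 sqrr_sign.
  by move: ((-1) ^+ i) => s ss; transitivity (- 2%:R * s * (s * s)); [ring|rewrite ss mulr1].
rewrite eqxx (_ : (_ == _) = false) ?sub0r; last by lia.
rewrite sqrrN expr1n mulr1 exprS; have : (-1) ^+ j * (-1) ^+ j = 1 :> K by rewrite -expr2 sqrr_sign.
by move: ((-1) ^+ j) => s ss; transitivity (2%:R * s * (s * s)); [ring|rewrite ss; ring].
Qed.

Lemma commutDr X (A B : M) : commut X (A + B) = commut X A + commut X B.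
Proof. by rewrite /commut mulmxDl mulmxDr opprD addrACA. Qed.

Lemma commut_scalar X (a : K) : commut X a%:M = 0.
Proof. by rewrite /commut mul_mx_scalar mul_scalar_mx subrr. Qed.

Lemma omega_b0bn : omega 'b_0 'b_n = 1 :> K.
Proof.
rewrite omega_bvec; [|lia|lia].
by rewrite add0n eqxx (_ : (_ == _) = false) ?subr0 //; lia.
Qed.

(** The wedge has trace -2, compensated by the trace of 1/n times the identity of size 2n. *)
Lemma sadj_head_subproof : wedge 'b_0 'b_n + (n%:R^-1)%:M \in @sadj_pred K n.
Proof.
apply/sadj_predP; split.
  rewrite linearD /= tr_scalar_mx mulmxDl mulmxDr mul_scalar_mx mul_mx_scalar.
  by congr (_ + _); rewrite /wedge linearB /= mulmxBl !rank1_tr_form mulmxBr opprK addrC.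
rewrite mxtraceD mxtrace_scalar /wedge mxtraceD -scaleN1r mxtraceZ !mxtrace_rank1.
have nV : n%:R^-1 *+ n = 1 :> K by rewrite -[LHS]mulr_natr mulVf // pnatr_eq0; lia.
rewrite (omegaC 'b_0 'b_n) omega_b0bn mulr1 mulrnDr nV.
by rewrite addrACA addNr addr0.
Qed.
(** Up to a scalar, the projection onto the plane of [b_0, b_n], made traceless;
    the generators other than the second preserve that plane and act on it by
    nothing or by the transvection along [b_0], hence kill this vector. *)
Definition sadj_head : sadj K n := Sadj sadj_head_subproof.

Lemma commut_head u : commut (rank1 u u) sadj_head =
  omega u 'b_0 *: wedge u 'b_n - omega u 'b_n *: wedge u 'b_0.
Proof. by rewrite [sadj_mx _]/= (commutDr (symp_rank1 u)) (commut_scalar (symp_rank1 u)) addr0 commut_rank1_wedge. Qed.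

Lemma omega_chain_b0 k : (k < n + n)%N -> omega (v k) 'b_0 = - (k == 1%N)%:R :> K.
Proof.
move=> kn; have -> : 'b_0 = v 0 :> vec by [].
by rewrite omega_chain ?sub0r //; lia.
Qed.

Lemma omega_chain_bn k : (k < n + n)%N -> omega (v k) 'b_n = (k == 0%N)%:R :> K.
Proof.
move=> kn; have bF (b : bool) : ~~ b -> b%:R = 0 :> K by move=> /negPf ->.
rewrite /chain; case: ifP => ko.
  rewrite omegaC omegaB; case: (ltnP k./2.+1 n) => kn'.
    by rewrite !omega_bvec ?bF ?subrr ?oppr0 //; lia.
  rewrite (@bvec_big _ _ (n + k./2).+1); last by lia.
  have -> : omega 'b_n 0 = 0 :> K by have := omegaB 'b_n 0 0; rewrite !subrr.
  by rewrite omega_bvec ?bF ?subrr ?subr0 ?oppr0 //; lia.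
rewrite omega_bvec; [|lia|lia].
rewrite [X in _ - X]bF ?subr0; last by lia.
by congr (_%:R); lia.
Qed.

Lemma sp_gen_head j : (j < n + n)%N -> j != 1%N -> rho0 (sp_gen j) sadj_head = 0.
Proof.
move=> jm j1; apply: val_inj; apply: (etrans (y := (-1) ^+ j *: commut (rank1 (v j) (v j)) sadj_head)).
  by rewrite -commutZl.
rewrite commut_head omega_chain_b0 // omega_chain_bn // (negPf j1) oppr0 scale0r sub0r.
have [->|_] := eqVneq j 0%N; first by rewrite wedgexx scaler0 oppr0 scaler0.
by rewrite scale0r oppr0 scaler0.
Qed.

(** The transvection along u sends p to [wedge u (p u)], and omega (u, u) = omega (u, p u) = 0, so a
    second application gives 0. *)
Lemma sp_gen_sq j p : rho0 (sp_gen j) (rho0 (sp_gen j) p) = 0.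
Proof.
apply: val_inj; apply: (etrans (y := (-1) ^+ j *: ((-1) ^+ j *:
    commut (rank1 (v j) (v j)) (commut (rank1 (v j) (v j)) p)))).
  by rewrite -commutZr -commutZl -commutZl.
rewrite commut_rank1_sadj commut_rank1_wedge omegaxx omega_sadjxx.
by rewrite !scale0r subrr !scaler0.
Qed.

Definition model_gen k : S :=
  (sp_gen k, (if k == 0%N then sadj_head else 0, (k == 0%N)%:R)).

Lemma model_lieE X Y p q (c d : K^o) :
  [lie ((X, (p, c)) : S), ((Y, (q, d)) : S)] =
  ([lie X, Y], (rho0 X q - rho0 Y p, 0)) :> S.
Proof. by congr pair; congr pair; rewrite /= subr0. Qed.

Lemma model_gen_far i j : (i < n + n)%N -> (j < n + n)%N ->
  (i.+1 < j)%N || (j.+1 < i)%N -> [lie model_gen i, model_gen j] = 0.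
Proof.
move=> im jm ij; rewrite /model_gen model_lieE sp_gen_far //.
(* The action is nonzero only for k = 1 and l = 0, which are adjacent. *)
have cross k l : (k < n + n)%N -> (k != 1%N) || (l != 0%N) ->
    rho0 (sp_gen k) (if l == 0%N then sadj_head else 0) = 0.
  move=> km; case: (l == 0%N); last by rewrite rep0.
  by rewrite orbF; apply: sp_gen_head.
by rewrite !cross ?subrr //; lia.
Qed.

Lemma model_gen_adj i j : (i < n + n)%N -> (j < n + n)%N ->
  (i.+1 == j) || (j.+1 == i) -> i != 0%N ->
  [lie model_gen i, [lie model_gen i, model_gen j]] = (- 2%:R) *: model_gen i.
Proof.
move=> im jm ij i0; rewrite /model_gen !model_lieE sp_gen_adj //.
rewrite (negPf i0) !rep0 !subr0 sp_gen_sq; congr pair; congr pair; by rewrite /= scaler0.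
Qed.

(** Measures the failure of the type A relation: the abelian part would have to be -2 times
    [sadj_head] with trivial component -2. *)
Lemma model_gen_sq01 :
  [lie model_gen 0, [lie model_gen 0, model_gen 1]] =
  ((- 2%:R) *: sp_gen 0,
   ((- 2%:R) *: rho0 (sp_gen 0) (rho0 (sp_gen 1) sadj_head), 0)) :> S.
Proof.
have -> : model_gen 0 = (sp_gen 0, (sadj_head, 1)) by [].
have -> : model_gen 1 = (sp_gen 1, (0, 0)) by [].
rewrite !model_lieE sp_gen_adj //; [|lia|lia].
rewrite rep0 sub0r rep_bracket (sp_gen_head (j := 0)) //; last by lia.
rewrite rep0 subr0 -[- rho0 _ sadj_head]scaleN1r repZr scaleN1r -opprD.
by congr pair; congr pair; rewrite scaleNr scaler_nat mulr2n.
Qed.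

Lemma model_gen_first :
  [lie model_gen 0, [lie model_gen 0, [lie model_gen 0, model_gen 1]]] = 0.
Proof.
have -> : model_gen 0 = (sp_gen 0, (sadj_head, 1)) by [].
rewrite model_gen_sq01 model_lieE lieZr liexx scaler0 repZr sp_gen_sq scaler0.
by rewrite repZl (sp_gen_head (j := 0)) ?scaler0 ?subrr //; lia.
Qed.

Lemma electricalC_model : exists f : {linear electricalC K (2 * n) -> S},
  (forall x y, f [lie x, y] = [lie f x, f y]) /\
  forall k, (k < n + n)%N -> exists x, f x = model_gen k.
Proof.
have N2 : (2 * n = n + n)%N by rewrite mul2n addnn.
have lt2 (i : 'I_(2 * n)) : (i < n + n)%N by rewrite -N2.
have [|f [fM fg _]] := @presented_lie_universal K _ (@electricalC_rel K (2 * n)) S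
    (fun i => model_gen i).
  move=> s t [i j ij|i j /andP[ij i0]|i j /andP[/eqP i0 /eqP j1]] /=.
  - exact: model_gen_far.
  - exact: model_gen_adj.
  by rewrite i0 j1 model_gen_first.
exists f; split=> // k kn; rewrite -N2 in kn.
by exists (pl_gen _ (Ordinal kn)); rewrite fg.
Qed.

(** * Surjectivity and injectivity of the model *)

Lemma chain_span (P : vec -> Prop) : subspace P ->
  (forall k, (k < n + n)%N -> P (v k)) -> forall k, P 'b_k.
Proof.
move=> sP Pv k; case: (ltnP k n) => [kn|nk].
  have -> : 'b_k = v k.*2 :> vec by rewrite /chain odd_double doubleK.
  by apply: Pv; lia.
have [big|kN] := leqP (n + n) k; first by rewrite bvec_big //; case: sP.
(* The odd chain vectors telescope downwards from [bvec (n + n) = 0]. *)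
have {nk kN} [r rn ->] : exists2 r, (r <= n)%N & k = (n + n - r)%N.
  by exists (n + n - k)%N; lia.
elim: r rn => [|r IHr] rn; first by rewrite subn0 bvec_big //; case: sP.
have -> : 'b_(n + n - r.+1)%N = v (n - r.+1).*2.+1 + 'b_(n + n - r)%N :> vec.
  rewrite /chain /= odd_double /= uphalf_double.
  by rewrite (_ : (n + (n - r.+1)).+1 = n + n - r)%N ?subrK; [congr bvec|]; lia.
by apply: subspaceD => //; [apply: Pv; lia | apply: IHr; lia].
Qed.

Lemma sym2_is_linearl (c : K) (u u' w : vec) :
  sym2 (c *: u + u') w = c *: sym2 u w + sym2 u' w.
Proof. by rewrite /sym2 rank1_is_linearl rank1_is_linearr scalerDr addrACA. Qed.

Lemma sym2C (u w : vec) : sym2 u w = sym2 w u.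
Proof. by rewrite /sym2 addrC. Qed.

(** The chain vectors span, so it suffices to reach each [sym2] of v_i and v_j. Bracketing the
    square of v_(i+d+1) with [sym2] of v_i and v_(i+d) gives a nonzero multiple of [sym2] of v_i and
    v_(i+d+1). *)
Lemma symp_generated (Q : M -> Prop) : subspace Q ->
  (forall X Y, Q X -> Q Y -> Q [lie X, Y]) ->
  (forall k, (k < n + n)%N -> Q (sp_gen k)) -> forall X, Q X.
Proof.
move=> sQ Qlie Qgen; apply: symp_sym2_span => // a b.
have QZ (c : K) A : c != 0 -> Q (c *: A) -> Q A.
  by move=> c0 /(subspaceZ c^-1 sQ); rewrite scalerA mulVf ?scale1r.
have Qr k : (k < n + n)%N -> Q (sym2 (v k) (v k)).
  move=> kn; rewrite sym2xx; apply: subspaceZ => //.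
  by apply: (@QZ ((-1) ^+ k)); rewrite ?signr_eq0 //; apply: Qgen.
have Qv i d : (i + d < n + n)%N -> Q (sym2 (v i) (v (i + d))).
  elim: d => [|d IHd] idn; first by rewrite addn0; apply: Qr; lia.
  have Qs := Qlie (symp_sym2 (v (i + d.+1)) (v (i + d.+1))) (symp_sym2 (v i) (v (i + d)))
     (Qr _ idn) (IHd (ltnW (leq_trans _ idn))).
  have {Qs} : Q (commut (sym2 (v (i + d.+1)) (v (i + d.+1))) (sym2 (v i) (v (i + d)))).
    by apply: Qs; lia.
  rewrite commut_sym2 !omega_chain; [|lia..].
  have -> : (i + d == (i + d.+1).+1) = false by lia.
  have -> : (i + d.+1 == (i + d).+1) by lia.
  have -> : (i == (i + d.+1).+1) = false by lia.
  have -> : (i + d.+1 == i.+1) = (d == 0%N) by lia.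
  case: (eqVneq d 0%N) => [->|d0].
    rewrite addn0 sym2C -!scalerDl sym2C; apply: QZ.
    by rewrite sub0r -!opprD oppr_eq0 -!(natrD _ _ 1%N) pnatr_eq0.
  rewrite !mulr0n subrr !scale0r add0r addr0 sub0r -scalerDl sym2C; apply: QZ.
  by rewrite -opprD oppr_eq0 -(natrD _ 1 1) pnatr_eq0.
have Qvv i j : (i < n + n)%N -> (j < n + n)%N -> Q (sym2 (v i) (v j)).
  move=> im jm; wlog ij : i j im jm / (i <= j)%N.
    by move=> H; case: (leqP i j) => [|/ltnW] ij; [|rewrite sym2C]; apply: H.
  by rewrite -(subnKC ij); apply: Qv; rewrite subnKC.
have sub w : subspace (fun u => Q (sym2 u w)).
  split=> [|c u u' Qu Qu']; last by rewrite sym2_is_linearl; case: sQ => _; apply.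
  rewrite -(scale0r (0 : vec)) -[_ *: _]addr0 sym2_is_linearl scale0r add0r.
  by rewrite /sym2 /rank1 trmx0 mulmx0 !mul0mx addr0; case: sQ.
apply: (chain_span (sub _)) => i im; rewrite sym2C.
by apply: (chain_span (sub _)) => j jm; apply: Qvv.
Qed.

Lemma sp_gen1_head : rho0 (sp_gen 1) sadj_head = wedge (v 1) 'b_n :> M.
Proof.
apply: (etrans (y := (-1) ^+ 1 *: commut (rank1 (v 1) (v 1)) sadj_head)).
  by rewrite -commutZl.
rewrite commut_head omega_chain_b0; last by lia.
rewrite omega_chain_bn; last by lia.
by rewrite scale0r subr0 scalerA expr1 mulrNN mulr1 scale1r.
Qed.

Lemma sp_gen01_head : rho0 (sp_gen 0) (rho0 (sp_gen 1) sadj_head) =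
  wedge (v 0) 'b_n - wedge (v 0) (v 1) :> M.
Proof.
apply: (etrans (y := (-1) ^+ 0 *: commut (rank1 (v 0) (v 0)) (wedge (v 1) 'b_n))).
  by rewrite -sp_gen1_head -commutZl.
rewrite commut_rank1_wedge expr0 scale1r omega_chain; [|lia|lia].
rewrite omega_chain_bn; last by lia.
by rewrite subr0 !scale1r.
Qed.

(** Its nonzero value shows that the image of the model meets [V_lambda] nontrivially. *)
Lemma sp_gen201_head :
  rho0 (sp_gen 2) (sadj_head - rho0 (sp_gen 0) (rho0 (sp_gen 1) sadj_head)) =
  wedge 'b_1 'b_0 :> M.
Proof.
rewrite rep_actB (sp_gen_head (j := 2)) //; last by lia.
rewrite sub0r; apply: (etrans (y := - ((-1) ^+ 2 *:
    commut (rank1 (v 2) (v 2)) (wedge (v 0) 'b_n - wedge (v 0) (v 1))))).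
  by rewrite -sp_gen01_head -commutZl.
rewrite sqrrN expr1n scale1r (commutDr (symp_rank1 (v 2))) -[- wedge _ (v 1)]scaleN1r commutZr.
rewrite !commut_rank1_wedge omega_chain; [|lia|lia].
rewrite omega_chain_bn; last by lia.
rewrite omega_chain; [|lia|lia].
rewrite !mulr0n subrr !scale0r subrr !sub0r add0r scaleN1r opprK.
by rewrite scaleN1r opprK.
Qed.

(** Split A J into symmetric and skew-symmetric halves, then remove the trace from the skew part. *)
Lemma mx_symp_sadj (A : M) : exists X p (c : K), (X : M) + (p : M) + c%:M = A.
Proof.
have two : 2%:R != 0 :> K by rewrite pnatr_eq0.
have nn : (n + n)%:R != 0 :> K by rewrite pnatr_eq0; lia.
pose B := A *m J; pose X0 := - 2%:R^-1 *: (B + B^T) *m J.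
pose P0 := - 2%:R^-1 *: (B - B^T) *m J; pose c := (n + n)%:R^-1 * \tr P0.
have BJ : - (B *m J) = A by rewrite -mulmxA symp_form_sq mulmxN mulmx1 opprK.
have symp0 : X0 \in symp_pred (K := K) (n := n).
  apply/symp_predP; rewrite trmx_mul linearZ linearD /= trmxK symp_form_tr.
  by rewrite [B^T + B]addrC !mulNmx mulmxA addNr.
have sadj0 : P0 - c%:M \in @sadj_pred K n.
  apply/sadj_predP; split.
    rewrite linearB /= tr_scalar_mx mulmxBl mulmxBr mul_scalar_mx mul_mx_scalar.
    congr (_ - _); rewrite trmx_mul linearZ linearB /= trmxK symp_form_tr mulmxA.
    by rewrite mulNmx -mulmxN -scalerN opprB.
  rewrite mxtraceD -scaleN1r mxtraceZ mxtrace_scalar -mulr_natr /c mulrAC mulVf //.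
  by rewrite mul1r mulN1r subrr.
exists (Symplectic symp0), (Sadj sadj0), c; rewrite /= addrA subrK.
rewrite /X0 /P0 -mulmxDl -scalerDr addrACA subrr addr0 -mulr2n -scaler_nat scalerA.
by rewrite mulNr mulVf // scaleN1r mulNmx.
Qed.

Lemma electricalC_sadj_iso : lie_isomorphic (electricalC K (2 * n)) S.
Proof.
have [f [fM fg]] := electricalC_model.
pose Im (z : S) := exists x, f x = z.
have sIm : subspace Im.
  split=> [|a z z' [x <-] [y <-]]; first by exists 0; rewrite linear0.
  by exists (a *: x + y); rewrite linearP.
have ImM z z' : Im z -> Im z' -> Im [lie z, z'].
  by move=> [x <-] [y <-]; exists [lie x, y]; rewrite fM.
have Im_sp X : exists q : sadj K n * K^o, Im (X, q).
  have [Y /val_inj <- //] : exists2 Y : sp, symp_mx Y = X & exists q : sadj K n * K^o, Im (Y, q).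
  apply: (symp_generated (Q := fun A => exists2 Y : sp, symp_mx Y = A & exists q : sadj K n * K^o, Im (Y, q))).
  - split=> [|a A B [Y <- [q Iq]] [Z <- [r Ir]]].
      by exists 0 => //; exists 0; case: sIm.
    exists (a *: Y + Z) => //; exists (a *: q + r).
    by case: sIm => _ /(_ a _ _ Iq Ir).
  - move=> Y Z [Y' /val_inj-> [[q c] Iq]] [Z' /val_inj-> [[r d] Ir]].
    exists [lie Y, Z] => //; have := ImM _ _ Iq Ir.
    by rewrite model_lieE => I; eexists; apply: I.
  by move=> k kn; exists (sp_gen k) => //; eexists; apply: fg kn.
have Im_act X p c : Im (0, (p, c)) -> Im (0, (rho0 X p, 0)).
  move=> Ip; have [[q d] Iq] := Im_sp X; have := ImM _ _ Iq Ip.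
  by rewrite model_lieE lie0r -[X in _ - rho0 X _](scale0r 0) repZl scale0r subr0.
(* Adding half of [e_1, [e_1, e_2]] to e_1 cancels the symplectic components and leaves [y] with
   trivial component 1. *)
pose y := sadj_head - rho0 (sp_gen 0) (rho0 (sp_gen 1) sadj_head).
have Iy : Im (0, (y, 1)).
  have [I0 I1] : Im (model_gen 0) /\ Im (model_gen 1) by split; apply: fg; lia.
  have := subspaceD sIm I0 (subspaceZ 2%:R^-1 sIm (ImM _ _ I0 (ImM _ _ I0 I1))).
  rewrite model_gen_sq01; congr (Im _).
  have two : 2%:R != 0 :> K by rewrite pnatr_eq0.
  have half (V : lmodType K) (u : V) : 2%:R^-1 *: (- 2%:R *: u) = - u.
    by rewrite scalerA mulrN mulVf // scaleN1r.
  congr pair; last congr pair.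
  - by rewrite /= half subrr.
  - by rewrite /= half.
  by rewrite /= scaler0 addr0.
have Iall p : Im (0, (p, 0)).
  have [_ irr] := sadj_irreducible K n2.
  (* This submodule is nonzero: the action on [y] of an image element lying over [sp_gen 2] kills
     the trivial component and yields the wedge of b_1 and b_0. *)
  have [|I0|//] := irr (fun p => Im (0, (p, 0))).
    split=> [|a q r Iq Ir|X q Iq]; first by case: sIm.
      have := sIm.2 a _ _ Iq Ir; congr (Im _).
      by congr pair; last congr pair; rewrite /= scaler0 addr0.
    exact: Im_act Iq.
  have /(congr1 (@sadj_mx K n)) := I0 _ (Im_act (sp_gen 2) _ _ Iy).
  have [n0 n1] : (0 < n)%N /\ (1 < n)%N by lia.
  have := @wedge_ll_neq0 K n (Ordinal n1) (Ordinal n0) isT.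
  by rewrite sp_gen201_head.
have I1 : Im (0, (0, 1)).
  have := subspaceB sIm Iy (Iall y); congr (Im _).
  by congr pair; last congr pair; rewrite /= ?subr0 ?subrr.
have Imall z : Im z.
  case: z => X [p c]; have [[q d] Iq] := Im_sp X.
  have := subspaceD sIm (subspaceD sIm Iq (Iall (p - q))) (subspaceZ (c - d) sIm I1).
  congr (Im _); congr pair; last congr pair; rewrite /=.
  - by rewrite scaler0 !addr0.
  - by rewrite scaler0 addr0 addrC subrK.
  by rewrite addr0 [_ *: _]mulr1 addrC subrK.
(* A linear comparison with gl_2n, whose dimension (2n)^2 is the size of the spanning family;
   injectivity of the composite forces that of [f]. *)
pose hfun (z : S) : M := (z.1 : M) + (z.2.1 : M) + (z.2.2)%:M.
have h_lin : linear hfun.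
  move=> a [X [p c]] [X' [p' c']]; rewrite /hfun /=.
  have -> : (a *: c + c')%:M = a *: c%:M + c'%:M :> M.
    by rewrite scale_scalar_mx -raddfD.
  by rewrite !scalerDr (addrACA (a *: symp_mx X)) (addrACA (a *: symp_mx X + _)).
pose hM := GRing.isLinear.Build _ _ _ _ hfun h_lin.
pose h : {linear S -> M} := HB.pack hfun hM.
have h_surj A : exists z, h z = A.
  by have [X [p [c <-]]] := mx_symp_sadj A; exists (X, (p, c)).
pose hf : {linear electricalC K (2 * n) -> M} := h \o f.
have N2 : (2 * n = n + n)%N by rewrite mul2n addnn.
have [x x_span] := electricalC_span K (2 * n).
have hf_inj : injective hf.
  apply: (surj_span_inj _ x_span); first by rewrite card_prod card_ord N2.
  by move=> A; have [z <-] := h_surj A; have [w <-] := Imall z; exists w.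
have f_inj : injective f by move=> u w fuw; apply: hf_inj; rewrite /hf /= fuw.
have [g gK] := choice Imall.
exists f; split=> //; exists g => // u; apply: f_inj; exact: gK.
Qed.

End ElectricalModel.

(** * Transport to an arbitrary irreducible module of highest weight lambda *)

Lemma lie_isomorphic_trans (K : fieldType) (L1 L2 L3 : lieAlgType K) :
  lie_isomorphic L1 L2 -> lie_isomorphic L2 L3 -> lie_isomorphic L1 L3.
Proof.
move=> [f [f_bij fM]] [g [g_bij gM]]; pose h : {linear L1 -> L3} := g \o f.
exists h; split; first exact: bij_comp.
by move=> x y; rewrite /h /= fM gM.
Qed.

Lemma semidirect_iso (K : fieldType) (L : lieAlgType K) (V1 V2 W : lmodType K)
    (rho1 : lie_rep L V1) (rho2 : lie_rep L V2) (sigma : lie_rep L W) (f : V1 -> V2) :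
  linear f -> bijective f -> (forall x w, f (rho1 x w) = rho2 x (f w)) ->
  lie_isomorphic (semidirect (rep_sum rho1 sigma)) (semidirect (rep_sum rho2 sigma)).
Proof.
move=> f_lin [g gK fK] f_rho.
pose F (z : semidirect (rep_sum rho1 sigma)) : semidirect (rep_sum rho2 sigma) :=
  (z.1, (f z.2.1, z.2.2)).
have F_lin : linear F by move=> a z z'; rewrite /F /= f_lin.
pose FM := GRing.isLinear.Build _ _ _ _ F F_lin.
pose Fl : {linear _ -> _} := HB.pack F FM.
exists Fl; split.
  by exists (fun z => (z.1, (g z.2.1, z.2.2))) => -[x [u w]] /=; rewrite /F /= ?gK ?fK.
move=> [x [u w]] [y [u' w']]; rewrite /= /F; congr (_, (_, _)).
by rewrite /= -!f_rho -scaleN1r addrC f_lin scaleN1r addrC.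
Qed.

Theorem theorem2p16 (R : realType) (n : nat) (hn : (2 <= n)%N) :
  (exists (V : lmodType R[i]) (rho : lie_rep (symplectic R[i] n) V),
     irreducible_highest_weight rho (@symp_lambda R[i] n)) /\
  (forall (V : lmodType R[i]) (rho : lie_rep (symplectic R[i] n) V),
     irreducible_highest_weight rho (@symp_lambda R[i] n) ->
     lie_isomorphic (electricalC R[i] (2 * n))
       (semidirect (rep_sum rho (rep_trivial (symplectic R[i] n) R[i]^o)))).
Proof.
have sadj_hw := sadj_highest_weight R[i] hn.
split; first by exists (sadj R[i] n), (sadj_rep R[i] n).
move=> V rho rho_hw.
have [f [f_lin f_bij f_rho]] := highest_weight_unique sadj_hw rho_hw.
exact: lie_isomorphic_trans (electricalC_sadj_iso R[i] hn) (semidirect_iso _ f_lin f_bij f_rho).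
Qed.
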